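(* Let $q \in (0,1)$ and let $k,l \in \mathbb{N}$ be coprime positive integers. For each $d \in \mathbb{N}$, the triple $\big(\mathcal{O}(L_q(dlk;k,l)), \mathcal{O}(U(1)), \mathcal{O}(W_q(k,l))\big)$ is a quantum principal $U(1)$-bundle.
   Context: $\mathbb{N}=\{1,2,\dots\}$, $\mathbb{N}_0 = \mathbb{N}\cup\{0\}$. $\mathcal{O}(S_q^3)$ is the universal unital complex $*$-algebra with generators $z_0,z_1$ and relations $z_0z_1 = q z_1z_0$, $z_0z_1^* = q z_1^*z_0$, $z_1 z_0^* = q z_0^* z_1$, $z_0z_0^* = z_0^*z_0 + (q^{-2}-1)z_1z_1^*$, $z_1z_1^* = z_1^*z_1$, $z_0z_0^*+z_1z_1^* = 1$. $\mathcal{O}(W_q(k,l))$ is the fixed point algebra of the circle action on $\mathcal{O}(S_q^3)$ by $*$-automorphisms $\sigma_w(z_0) = w^kz_0$, $\sigma_w(z_1) = w^lz_1$ ($w\in S^1$); it is the unital $*$-subalgebra generated by $z_0^l(z_1^* )^k$ and $z_1z_1^*$. $\mathcal{O}(L_q(dlk;k,l))$ is the fixed point algebra of the action of $\mathbb{Z}/(dlk)\mathbb{Z}$ on $\mathcal{O}(S_q^3)$ by $*$-automorphisms whose generator acts as $z_0\mapsto \exp(\tfrac{2\pi i}{dl})z_0$, $z_1\mapsto\exp(\tfrac{2\pi i}{dk})z_1$. For $n\in\mathbb{N}_0$ set $\mathscr{A}_{(n)}(k,l) := \sum_{j=0}^n (z_0^* )^{lj}(z_1^* )^{k(n-j)}\cdot\mathcal{O}(W_q(k,l))$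 and $\mathscr{A}_{(-n)}(k,l) := \sum_{j=0}^n z_0^{lj}z_1^{k(n-j)}\cdot\mathcal{O}(W_q(k,l))$. The subspaces $\{\mathscr{A}_{(dn)}(k,l)\}_{n\in\mathbb{Z}}$ make $\mathcal{O}(L_q(dlk;k,l))$ a $\mathbb{Z}$-graded unital $*$-algebra, with degree-zero part $\mathcal{O}(W_q(k,l))$. $\mathcal{O}(U(1)) := \mathbb{C}[z,z^{-1}]/\langle 1-zz^{-1}\rangle$ is a Hopf algebra with $\Delta(z^n) = z^n\otimes z^n$, $S(z^n) = z^{-n}$, $\varepsilon(z^n)=1$. A $\mathbb{Z}$-graded unital algebra $\mathscr{A}=\bigoplus_n\mathscr{A}_{(n)}$ is a right comodule algebra over $\mathcal{O}(U(1))$ via $\Delta_R(x) = x\otimes z^{-n}$ for $x\in\mathscr{A}_{(n)}$; the coinvariant subalgebra $\{x \mid \Delta_R(x) = x\otimes1\}$ is $\mathscr{A}_{(0)}$. This coaction, for the grading above, is the one used in the claim. For a right comodule algebra $\mathscr{A}$ over $\mathcal{O}(U(1))$ with coinvariant subalgebra $\mathscr{B}$, $(\mathscr{A},\mathcal{O}(U(1)),\mathscr{B})$ is a quantum principal $U(1)$-bundle when the canonical map $\mathscr{A}\otimes_{\mathscr{B}}\mathscr{A}\to\mathscr{A}\otimes\mathcal{O}(U(1))$, $x\otimes y\mapsto x\cdot\Delta_R(y)$, is an isomorphism. *)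

(* Defs.v *)
From HB Require Import structures.
From mathcomp Require Import all_boot all_order all_algebra.
From mathcomp Require Import generic_quotient ring_quotient complex.
From mathcomp Require Import boolp classical_sets reals trigo.

Set Implicit Arguments.
Unset Strict Implicit.
Unset Printing Implicit Defensive.

Import Order.TTheory GRing.Theory Num.Theory.
Local Open Scope ring_scope.
Local Open Scope quotient_scope.

(* [tensor ra la] is the quotient of the finite formal sums of elementary
   tensors, written as sequences of pairs, by the smallest congruence making
   them biadditive and balanced: (ra x s) (x) y = x (x) (la s y) for all s : S,
   where S acts on the right of M by ra and on the left of N by la. *)
Section Tensor.
Variables (S : Type) (M N : zmodType) (ra : M -> S -> M) (la : S -> N -> N).

Inductive tensor_cong : seq (M * N) -> seq (M * N) -> Prop :=
| tensor_refl s : tensor_cong s s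
| tensor_sym s t : tensor_cong s t -> tensor_cong t s
| tensor_trans s t u : tensor_cong s t -> tensor_cong t u -> tensor_cong s u
| tensor_cat s s' t t' :
    tensor_cong s s' -> tensor_cong t t' -> tensor_cong (s ++ t) (s' ++ t')
| tensor_comm s t : tensor_cong (s ++ t) (t ++ s)
| tensor_addl x x' y : tensor_cong [:: (x + x', y)] [:: (x, y); (x', y)]
| tensor_addr x y y' : tensor_cong [:: (x, y + y')] [:: (x, y); (x, y')]
| tensor_0l y : tensor_cong [:: (0, y)] [::]
| tensor_0r x : tensor_cong [:: (x, 0)] [::]
| tensor_balance x s y : tensor_cong [:: (ra x s, y)] [:: (x, la s y)].

Definition tensor_congb (s t : seq (M * N)) : bool := `[< tensor_cong s t >].

Lemma tensor_congb_refl : reflexive tensor_congb.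
Proof. by move=> s; apply/asboolP; exact: tensor_refl. Qed.

Lemma tensor_congb_sym : symmetric tensor_congb.
Proof. by move=> s t; apply/asboolP/asboolP; exact: tensor_sym. Qed.

Lemma tensor_congb_trans : transitive tensor_congb.
Proof.
move=> t s u /asboolP st /asboolP tu; apply/asboolP.
exact: tensor_trans st tu.
Qed.

Canonical tensor_equiv :=
  EquivRel tensor_congb tensor_congb_refl tensor_congb_sym tensor_congb_trans.

Definition tensor := {eq_quot tensor_equiv}.

HB.instance Definition _ : EqQuotient _ tensor_equiv tensor :=
  EqQuotient.on tensor.
HB.instance Definition _ := Choice.on tensor.

Definition tensor_class (s : seq (M * N)) : tensor := \pi_tensor s.

Definition pure (x : M) (y : N) : tensor := tensor_class [:: (x, y)].

Lemma tensor_classP s t : tensor_class s = tensor_class t <-> tensor_cong s t.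
Proof.
split; first by move/eqmodP/asboolP.
by move=> st; apply/eqmodP/asboolP.
Qed.

Lemma repr_tensor (t : tensor) : tensor_class (repr t) = t.
Proof. exact: reprK. Qed.

Definition tensor_zero : tensor := tensor_class [::].
Definition tensor_add (s t : tensor) : tensor :=
  tensor_class (repr s ++ repr t).
Definition tensor_opp (s : tensor) : tensor :=
  tensor_class [seq (- p.1, p.2) | p <- repr s].

Lemma tensor_classD s t :
  tensor_add (tensor_class s) (tensor_class t) = tensor_class (s ++ t).
Proof.
by apply/tensor_classP; apply: tensor_cat;
  apply/tensor_classP; rewrite repr_tensor.
Qed.

Lemma tensor_addA : associative tensor_add.
Proof.
move=> s t u; rewrite -(repr_tensor s) -(repr_tensor t) -(repr_tensor u).
by rewrite !tensor_classD catA.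
Qed.

Lemma tensor_addC : commutative tensor_add.
Proof. by move=> s t; apply/tensor_classP; exact: tensor_comm. Qed.

Lemma tensor_add0 : left_id tensor_zero tensor_add.
Proof. by move=> s; rewrite -(repr_tensor s) tensor_classD. Qed.

Lemma tensor_addN : left_inverse tensor_zero tensor_opp tensor_add.
Proof.
move=> s; rewrite -{2}(repr_tensor s) tensor_classD; apply/tensor_classP.
elim: (repr s) => [|[x y] r IHr] /=; first exact: tensor_refl.
rewrite -cat1s -(cat1s (x, y)) -[X in tensor_cong X _]/([:: (- x, y)] ++ _).
apply: tensor_trans (_ : tensor_cong _
  (([:: (- x, y)] ++ [:: (x, y)]) ++ ([seq (- p.1, p.2) | p <- r] ++ r))) _.
  rewrite -catA; apply: tensor_cat; first exact: tensor_refl.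
  by rewrite !catA; apply: tensor_cat; [exact: tensor_comm|exact: tensor_refl].
rewrite -[X in tensor_cong _ X]cats0; apply: tensor_cat => //.
apply: tensor_trans (tensor_0l y).
by rewrite -(addNr x); apply/tensor_sym/tensor_addl.
Qed.

HB.instance Definition _ := GRing.isZmodule.Build tensor
  tensor_addA tensor_addC tensor_add0 tensor_addN.

Lemma pureDl x x' y : pure (x + x') y = pure x y + pure x' y.
Proof.
rewrite [RHS]tensor_classD; apply/tensor_classP; exact: tensor_addl.
Qed.

Lemma pureDr x y y' : pure x (y + y') = pure x y + pure x y'.
Proof.
rewrite [RHS]tensor_classD; apply/tensor_classP; exact: tensor_addr.
Qed.

Lemma pure_balance x s y : pure (ra x s) y = pure x (la s y).
Proof. by apply/tensor_classP; exact: tensor_balance. Qed.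

Lemma tensor_sum (t : tensor) : t = \sum_(p <- repr t) pure p.1 p.2.
Proof.
rewrite -{1}(repr_tensor t); elim: (repr t) => [|[x y] r IHr].
  by rewrite big_nil.
by rewrite big_cons -IHr [RHS]tensor_classD.
Qed.

(* The additive map induced by a biadditive balanced map f (see
   tensor_lift_pure); it is meaningless for other f. *)
Definition tensor_lift (V : zmodType) (f : M -> N -> V) (t : tensor) : V :=
  \sum_(p <- repr t) f p.1 p.2.

Section Lift.
Variables (V : zmodType) (f : M -> N -> V).
Hypotheses (fDl : forall x x' y, f (x + x') y = f x y + f x' y)
           (fDr : forall x y y', f x (y + y') = f x y + f x y')
           (f_bal : forall x s y, f (ra x s) y = f x (la s y)).

Lemma tensor_cong_lift s t : tensor_cong s t ->
  \sum_(p <- s) f p.1 p.2 = \sum_(p <- t) f p.1 p.2.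
Proof.
have f0l y : f 0 y = 0.
  by have /eqP := fDl 0 0 y; rewrite addr0 -subr_eq subrr eq_sym => /eqP.
have f0r x : f x 0 = 0.
  by have /eqP := fDr x 0 0; rewrite addr0 -subr_eq subrr eq_sym => /eqP.
elim => {s t}
  [//|s t _ ->//|s t u _ -> _ ->//|s s' t t' _ IHs _ IHt|s t|x x' y|x y y'
  |y|x|x s y].
- by rewrite !big_cat /= IHs IHt.
- by rewrite !big_cat /= addrC.
- by rewrite !big_cons !big_nil !addr0 fDl.
- by rewrite !big_cons !big_nil !addr0 fDr.
- by rewrite big_cons !big_nil f0l addr0.
- by rewrite big_cons !big_nil f0r addr0.
- by rewrite !big_cons !big_nil f_bal.
Qed.

Lemma tensor_lift_class s :
  tensor_lift f (tensor_class s) = \sum_(p <- s) f p.1 p.2.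
Proof. by apply/tensor_cong_lift/tensor_classP; rewrite repr_tensor. Qed.

Lemma tensor_lift_pure x y : tensor_lift f (pure x y) = f x y.
Proof. by rewrite tensor_lift_class big_cons big_nil addr0. Qed.

Lemma tensor_liftD s t :
  tensor_lift f (s + t) = tensor_lift f s + tensor_lift f t.
Proof.
rewrite -(repr_tensor s) -(repr_tensor t) [_ + _]tensor_classD.
by rewrite !tensor_lift_class big_cat.
Qed.

End Lift.
End Tensor.

Section TensorOverField.
Variables (C : comNzRingType) (M N : lmodType C).

Definition ctensor : Type :=
  tensor (fun (x : M) (c : C) => c *: x) (fun (c : C) (y : N) => c *: y).

HB.instance Definition _ := GRing.Zmodule.on ctensor.

Definition cpure (x : M) (y : N) : ctensor := pure _ _ x y.

Definition clift (V : zmodType) (f : M -> N -> V) (t : ctensor) : V :=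
  tensor_lift f t.

Definition ctensor_scale (c : C) (t : ctensor) : ctensor :=
  clift (fun x y => cpure (c *: x) y) t.

Let scaleDl c x x' y :
  cpure (c *: (x + x')) y = cpure (c *: x) y + cpure (c *: x') y.
Proof. by rewrite scalerDr; exact: pureDl. Qed.

Let scaleDr c x y y' :
  cpure (c *: x) (y + y') = cpure (c *: x) y + cpure (c *: x) y'.
Proof. exact: pureDr. Qed.

Let scale_bal c x a y : cpure (c *: (a *: x)) y = cpure (c *: x) (a *: y).
Proof. by rewrite scalerA mulrC -scalerA; exact: pure_balance. Qed.

Lemma ctensor_scale_pure c x y : ctensor_scale c (cpure x y) = cpure (c *: x) y.
Proof. exact: (tensor_lift_pure (scaleDl c) (scaleDr c) (scale_bal c)). Qed.

Lemma ctensor_scaleDr : right_distributive ctensor_scale +%R.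
Proof.
by move=> c s t; exact: (tensor_liftD (scaleDl c) (scaleDr c) (scale_bal c)).
Qed.

Lemma ctensor_ind (P : ctensor -> Prop) :
  P 0 -> (forall s t, P s -> P t -> P (s + t)) ->
  (forall x y, P (cpure x y)) -> forall t, P t.
Proof.
move=> P0 PD Pp t; rewrite (tensor_sum t).
by elim/big_ind: _ => // -[x y] _; exact: Pp.
Qed.

Lemma ctensor_scale0 c : ctensor_scale c 0 = 0.
Proof.
have /eqP := ctensor_scaleDr c 0 0.
by rewrite addr0 -subr_eq subrr eq_sym => /eqP.
Qed.

Lemma ctensor_scaleA a b t :
  ctensor_scale a (ctensor_scale b t) = ctensor_scale (a * b) t.
Proof.
elim/ctensor_ind: t => [|s t IHs IHt|x y]; first by rewrite !ctensor_scale0.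
  by rewrite !ctensor_scaleDr IHs IHt.
by rewrite !ctensor_scale_pure scalerA.
Qed.

Lemma ctensor_scale1 : left_id 1 ctensor_scale.
Proof.
elim/ctensor_ind => [|s t IHs IHt|x y]; first by rewrite ctensor_scale0.
  by rewrite ctensor_scaleDr IHs IHt.
by rewrite ctensor_scale_pure scale1r.
Qed.

Lemma ctensor_scaleDl t :
  {morph ctensor_scale^~ t : a b / a + b >-> a + b}.
Proof.
move=> a b; elim/ctensor_ind: t => [|s t IHs IHt|x y].
- by rewrite !ctensor_scale0 addr0.
- by rewrite !ctensor_scaleDr IHs IHt addrACA.
- by rewrite !ctensor_scale_pure scalerDl; exact: pureDl.
Qed.

HB.instance Definition _ := GRing.Zmodule_isLmodule.Build C ctensor
  ctensor_scaleA ctensor_scale1 ctensor_scaleDr ctensor_scaleDl.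

End TensorOverField.

Section OU1.
Variable C : fieldType.

(* C[z, z^-1] is rendered as polynomials in z over polynomials in z^-1. *)
Definition u1_ideal : {pred {poly {poly C}}} :=
  fun p => `[< exists r, p = r * (1 - 'X * ('X)%:P) >].

Lemma u1_idealr_closed : idealr_closed u1_ideal.
Proof.
split.
- by apply/asboolP; exists 0; rewrite mul0r.
- apply/negP => /asboolP[r] /(congr1 (fun p : {poly {poly C}} => p.[1].[1])).
  by rewrite !hornerE subrr mulr0 => /eqP; rewrite oner_eq0.
- move=> a _ _ /asboolP[r ->] /asboolP[s ->]; apply/asboolP.
  by exists (a * r + s); rewrite mulrDl mulrA.
Qed.

HB.instance Definition _ :=
  isIdealr.Build {poly {poly C}} u1_ideal u1_idealr_closed.

Definition OU1 : Type := {ideal_quot u1_ideal}.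

HB.instance Definition _ := GRing.ComNzRing.on OU1.

Definition u1_class (p : {poly {poly C}}) : OU1 := \pi_{ideal_quot u1_ideal} p.

Definition u1_repr (h : OU1) : {poly {poly C}} :=
  repr (h : {ideal_quot u1_ideal}).

Lemma u1_classD : {morph u1_class : p r / p + r}.
Proof. by move=> p r; rewrite /u1_class !piE. Qed.

Lemma u1_classM : {morph u1_class : p r / p * r}.
Proof. by move=> p r; rewrite /u1_class !piE. Qed.

Lemma u1_class1 : u1_class 1 = 1.
Proof. by rewrite /u1_class !piE. Qed.

Definition u1_scale (c : C) (h : OU1) : OU1 := u1_class c%:P%:P * h.

Lemma u1_scaleA a b h : u1_scale a (u1_scale b h) = u1_scale (a * b) h.
Proof. by rewrite /u1_scale mulrA -u1_classM -!polyCM. Qed.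

Lemma u1_scale1 : left_id 1 u1_scale.
Proof. by move=> h; rewrite /u1_scale u1_class1 mul1r. Qed.

Lemma u1_scaleDr : right_distributive u1_scale +%R.
Proof. by move=> c h h'; rewrite /u1_scale mulrDr. Qed.

Lemma u1_scaleDl h : {morph u1_scale^~ h : a b / a + b}.
Proof. by move=> a b; rewrite /u1_scale !polyCD u1_classD mulrDl. Qed.

HB.instance Definition _ := GRing.Zmodule_isLmodule.Build C OU1
  u1_scaleA u1_scale1 u1_scaleDr u1_scaleDl.

Lemma u1_scaleAl (c : C) (h h' : OU1) : c *: (h * h') = (c *: h) * h'.
Proof. exact: mulrA. Qed.

HB.instance Definition _ := GRing.Lmodule_isLalgebra.Build C OU1 u1_scaleAl.

Definition u1_pow (n : int) : OU1 :=
  match n with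
  | Posz m => u1_class 'X ^+ m
  | Negz m => u1_class ('X)%:P ^+ m.+1
  end.

(* Linear extensions of z^n |-> z^n (x) z^n and z^n |-> 1. *)
Definition u1_comul (h : OU1) : ctensor OU1 OU1 :=
  let p := u1_repr h in
  \sum_(i < size p) \sum_(j < size p`_i)
    p`_i`_j *: cpure (u1_pow (i%:Z - j%:Z)) (u1_pow (i%:Z - j%:Z)).

Definition u1_counit (h : OU1) : C := (u1_repr h).[1].[1].

End OU1.

Section PrincipalBundle.
Variables (C : fieldType) (A : algType C).
Local Notation H := (OU1 C).

Definition ctensor_mul (s t : ctensor A H) : ctensor A H :=
  clift (fun a h => clift (fun a' h' => cpure (a * a') (h * h')) t) s.

Definition is_comodule_algebra (delta : A -> ctensor A H) : Prop :=
  [/\ forall (c : C) x y, delta (c *: x + y) = c *: delta x + delta y,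
      delta 1 = cpure 1 1,
      forall x y, delta (x * y) = ctensor_mul (delta x) (delta y),
      forall x,
        clift (fun a h => cpure (delta a) h) (delta x) =
        clift (fun a h => clift (fun h1 h2 => cpure (cpure a h1) h2)
                            (u1_comul h)) (delta x)
            :> ctensor (ctensor A H) H
    & forall x, clift (fun a h => u1_counit h *: a) (delta x) = x].

Definition coinvariants (delta : A -> ctensor A H) : {pred A} :=
  fun x => `[< delta x = cpure x 1 >].

(* A (x)_B A. Balancing over C is implied as soon as B contains C 1. *)
Definition tensor_over (B : {pred A}) : Type :=
  tensor (fun (x : A) (b : {b : A | b \in B}) => x * val b)
         (fun (b : {b : A | b \in B}) (y : A) => val b * y).

Definition canonical_map (B : {pred A}) (delta : A -> ctensor A H)
    (t : tensor_over B) : ctensor A H :=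
  tensor_lift (fun x y => clift (fun a h => cpure (x * a) h) (delta y)) t.

Definition quantum_principal_U1_bundle
    (delta : A -> ctensor A H) (B : {pred A}) : Prop :=
  [/\ is_comodule_algebra delta,
      coinvariants delta =i B
    & bijective (@canonical_map B delta)].

(* The coaction of a Z-grading A = (+)_n G n: x = sum_n x_n is sent to
   sum_n x_n (x) z^(-n). The decomposition is picked by choice; when G is a
   grading the result does not depend on it. *)
Definition decomposes (G : int -> set A) (x : A) (s : seq (int * A)) : Prop :=
  (forall p, p \in s -> G p.1 p.2) /\ x = \sum_(p <- s) p.2.

Definition graded_coaction (G : int -> set A) (x : A) : ctensor A H :=
  \sum_(p <- xget [::] [set s | decomposes G x s]%classic)
     cpure p.2 (u1_pow C (- p.1)).

End PrincipalBundle.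

Section QuantumSphere.
Variable C : numClosedFieldType.

Inductive sterm : Type :=
| Tz0 | Tz1 | Tzero | Tone
| Tadd of sterm & sterm | Tmul of sterm & sterm
| Tscale of C & sterm | Tstar of sterm.

Local Notation "x +t y" := (Tadd x y) (at level 50, left associativity).
Local Notation "x *t y" := (Tmul x y) (at level 40, left associativity).
Local Notation "c :t x" := (Tscale c x) (at level 40, left associativity).
Local Notation "x ^t" := (Tstar x) (at level 2, format "x ^t").

Inductive sq3_cong (q : C) : sterm -> sterm -> Prop :=
| sq3_refl x : sq3_cong q x x
| sq3_sym x y : sq3_cong q x y -> sq3_cong q y x
| sq3_trans x y z : sq3_cong q x y -> sq3_cong q y z -> sq3_cong q x z
| sq3_add x x' y y' :
    sq3_cong q x x' -> sq3_cong q y y' -> sq3_cong q (x +t y) (x' +t y')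
| sq3_mul x x' y y' :
    sq3_cong q x x' -> sq3_cong q y y' -> sq3_cong q (x *t y) (x' *t y')
| sq3_scale c x x' : sq3_cong q x x' -> sq3_cong q (c :t x) (c :t x')
| sq3_star x x' : sq3_cong q x x' -> sq3_cong q x^t x'^t
| sq3_addA x y z : sq3_cong q (x +t (y +t z)) (x +t y +t z)
| sq3_addC x y : sq3_cong q (x +t y) (y +t x)
| sq3_add0 x : sq3_cong q (Tzero +t x) x
| sq3_addN x : sq3_cong q ((-1 :t x) +t x) Tzero
| sq3_mulA x y z : sq3_cong q (x *t (y *t z)) (x *t y *t z)
| sq3_mul1l x : sq3_cong q (Tone *t x) x
| sq3_mul1r x : sq3_cong q (x *t Tone) x
| sq3_mulDl x y z : sq3_cong q ((x +t y) *t z) (x *t z +t y *t z)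
| sq3_mulDr x y z : sq3_cong q (x *t (y +t z)) (x *t y +t x *t z)
| sq3_scaleA a b x : sq3_cong q (a :t (b :t x)) ((a * b) :t x)
| sq3_scale1 x : sq3_cong q (1 :t x) x
| sq3_scaleDr a x y : sq3_cong q (a :t (x +t y)) ((a :t x) +t (a :t y))
| sq3_scaleDl a b x : sq3_cong q ((a + b) :t x) ((a :t x) +t (b :t x))
| sq3_scaleAl a x y : sq3_cong q (a :t (x *t y)) ((a :t x) *t y)
| sq3_scaleAr a x y : sq3_cong q (a :t (x *t y)) (x *t (a :t y))
| sq3_starK x : sq3_cong q x^t^t x
| sq3_starD x y : sq3_cong q (x +t y)^t (x^t +t y^t)
| sq3_starM x y : sq3_cong q (x *t y)^t (y^t *t x^t)
| sq3_starZ a x : sq3_cong q (a :t x)^t (a^* :t x^t)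
| sq3_z0z1 : sq3_cong q (Tz0 *t Tz1) (q :t (Tz1 *t Tz0))
| sq3_z0z1s : sq3_cong q (Tz0 *t Tz1^t) (q :t (Tz1^t *t Tz0))
| sq3_z1z0s : sq3_cong q (Tz1 *t Tz0^t) (q :t (Tz0^t *t Tz1))
| sq3_z0z0s : sq3_cong q (Tz0 *t Tz0^t)
    (Tz0^t *t Tz0 +t ((q ^- 2 - 1) :t (Tz1 *t Tz1^t)))
| sq3_z1z1s : sq3_cong q (Tz1 *t Tz1^t) (Tz1^t *t Tz1)
| sq3_sphere : sq3_cong q (Tz0 *t Tz0^t +t Tz1 *t Tz1^t) Tone.

(* The interpretation of terms under z0 |-> x0, z1 |-> x1. *)
Section Eval.
Variables (A : algType C) (star : A -> A) (x0 x1 : A).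

Fixpoint sq3_eval (t : sterm) : A :=
  match t with
  | Tz0 => x0
  | Tz1 => x1
  | Tzero => 0
  | Tone => 1
  | x +t y => sq3_eval x + sq3_eval y
  | x *t y => sq3_eval x * sq3_eval y
  | c :t x => c *: sq3_eval x
  | x^t => star (sq3_eval x)
  end.

Lemma sq3_eval_cong (q : C) :
  involutive star -> {morph star : x y / x + y} ->
  (forall x y, star (x * y) = star y * star x) ->
  (forall a x, star (a *: x) = a^* *: star x) ->
  x0 * x1 = q *: (x1 * x0) ->
  x0 * star x1 = q *: (star x1 * x0) ->
  x1 * star x0 = q *: (star x0 * x1) ->
  x0 * star x0 = star x0 * x0 + (q ^- 2 - 1) *: (x1 * star x1) ->
  x1 * star x1 = star x1 * x1 ->
  x0 * star x0 + x1 * star x1 = 1 ->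
  forall s t, sq3_cong q s t -> sq3_eval s = sq3_eval t.
Proof.
move=> sK sD sM sZ r1 r2 r3 r4 r5 r6 s t; elim=> {s t} //=.
- by move=> x y z _ -> _ ->.
- by move=> x x' y y' _ -> _ ->.
- by move=> x x' y y' _ -> _ ->.
- by move=> c x x' _ ->.
- by move=> x x' _ ->.
- by move=> *; rewrite addrA.
- by move=> *; rewrite addrC.
- by move=> *; rewrite add0r.
- by move=> *; rewrite scaleN1r addNr.
- by move=> *; rewrite mulrA.
- by move=> *; rewrite mul1r.
- by move=> *; rewrite mulr1.
- by move=> *; rewrite mulrDl.
- by move=> *; rewrite mulrDr.
- by move=> *; rewrite scalerA.
- by move=> *; rewrite scale1r.
- by move=> *; rewrite scalerDr.
- by move=> *; rewrite scalerDl.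
- by move=> *; rewrite scalerAl.
- by move=> *; rewrite scalerAr.
Qed.
End Eval.

HB.instance Definition _ := gen_eqMixin sterm.
HB.instance Definition _ := gen_choiceMixin sterm.

Variable q : C.

Definition sq3_congb (s t : sterm) : bool := `[< sq3_cong q s t >].

Lemma sq3_congb_refl : reflexive sq3_congb.
Proof. by move=> s; apply/asboolP; exact: sq3_refl. Qed.

Lemma sq3_congb_sym : symmetric sq3_congb.
Proof. by move=> s t; apply/asboolP/asboolP; exact: sq3_sym. Qed.

Lemma sq3_congb_trans : transitive sq3_congb.
Proof.
move=> t s u /asboolP st /asboolP tu; apply/asboolP; exact: sq3_trans st tu.
Qed.

Canonical sq3_equiv :=
  EquivRel sq3_congb sq3_congb_refl sq3_congb_sym sq3_congb_trans.

(* O(S_q^3), as the universal *-algebra: terms in z0, z1 modulo the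
   consequences of the *-algebra axioms and of the defining relations. *)
Definition sq3 := {eq_quot sq3_equiv}.

HB.instance Definition _ : EqQuotient _ sq3_equiv sq3 := EqQuotient.on sq3.
HB.instance Definition _ := Choice.on sq3.

Definition sq3_class (t : sterm) : sq3 := \pi_sq3 t.
Definition sq3_repr (x : sq3) : sterm := repr x.

Lemma sq3_classP s t : sq3_class s = sq3_class t <-> sq3_cong q s t.
Proof.
split; first by move/eqmodP/asboolP.
by move=> st; apply/eqmodP/asboolP.
Qed.

Lemma sq3_reprK : cancel sq3_repr sq3_class.
Proof. exact: reprK. Qed.

Lemma sq3_classK t : sq3_cong q (sq3_repr (sq3_class t)) t.
Proof. by apply/sq3_classP; rewrite sq3_reprK. Qed.

Definition sq3_addq (x y : sq3) :=
  locked (sq3_class (sq3_repr x +t sq3_repr y)).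
Definition sq3_mulq (x y : sq3) :=
  locked (sq3_class (sq3_repr x *t sq3_repr y)).
Definition sq3_scaleq (c : C) (x : sq3) :=
  locked (sq3_class (c :t sq3_repr x)).
Definition sq3_starq (x : sq3) := locked (sq3_class (sq3_repr x)^t).

Lemma sq3_addqE s t :
  sq3_addq (sq3_class s) (sq3_class t) = sq3_class (s +t t).
Proof.
by rewrite /sq3_addq -lock; apply/sq3_classP/sq3_add;
  exact: sq3_classK.
Qed.

Lemma sq3_mulqE s t :
  sq3_mulq (sq3_class s) (sq3_class t) = sq3_class (s *t t).
Proof.
by rewrite /sq3_mulq -lock; apply/sq3_classP/sq3_mul;
  exact: sq3_classK.
Qed.

Lemma sq3_scaleqE c t : sq3_scaleq c (sq3_class t) = sq3_class (c :t t).
Proof.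
by rewrite /sq3_scaleq -lock; apply/sq3_classP/sq3_scale;
  exact: sq3_classK.
Qed.

Lemma sq3_starqE t : sq3_starq (sq3_class t) = sq3_class t^t.
Proof.
by rewrite /sq3_starq -lock; apply/sq3_classP/sq3_star;
  exact: sq3_classK.
Qed.

Let sq3E := (sq3_addqE, sq3_mulqE, sq3_scaleqE, sq3_starqE).

Lemma sq3_addqA : associative sq3_addq.
Proof.
move=> x y z; rewrite -(sq3_reprK x) -(sq3_reprK y) -(sq3_reprK z) !sq3E.
exact/sq3_classP/sq3_addA.
Qed.

Lemma sq3_addqC : commutative sq3_addq.
Proof.
by move=> x y; rewrite -(sq3_reprK x) -(sq3_reprK y) !sq3E;
  exact/sq3_classP/sq3_addC.
Qed.

Lemma sq3_addq0 : left_id (sq3_class Tzero) sq3_addq.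
Proof. by move=> x; rewrite -(sq3_reprK x) sq3E; exact/sq3_classP/sq3_add0. Qed.

Lemma sq3_addqN : left_inverse (sq3_class Tzero) (sq3_scaleq (-1)) sq3_addq.
Proof.
by move=> x; rewrite -(sq3_reprK x) !sq3E;
  exact/sq3_classP/sq3_addN.
Qed.

HB.instance Definition _ := GRing.isZmodule.Build sq3
  sq3_addqA sq3_addqC sq3_addq0 sq3_addqN.

Lemma sq3_mulqA : associative sq3_mulq.
Proof.
move=> x y z; rewrite -(sq3_reprK x) -(sq3_reprK y) -(sq3_reprK z) !sq3E.
exact/sq3_classP/sq3_mulA.
Qed.

Lemma sq3_mulq1l : left_id (sq3_class Tone) sq3_mulq.
Proof.
by move=> x; rewrite -(sq3_reprK x) sq3E;
  exact/sq3_classP/sq3_mul1l.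
Qed.

Lemma sq3_mulq1r : right_id (sq3_class Tone) sq3_mulq.
Proof.
by move=> x; rewrite -(sq3_reprK x) sq3E;
  exact/sq3_classP/sq3_mul1r.
Qed.

Lemma sq3_mulqDl : left_distributive sq3_mulq sq3_addq.
Proof.
move=> x y z; rewrite -(sq3_reprK x) -(sq3_reprK y) -(sq3_reprK z) !sq3E.
exact/sq3_classP/sq3_mulDl.
Qed.

Lemma sq3_mulqDr : right_distributive sq3_mulq sq3_addq.
Proof.
move=> x y z; rewrite -(sq3_reprK x) -(sq3_reprK y) -(sq3_reprK z) !sq3E.
exact/sq3_classP/sq3_mulDr.
Qed.

(* The character z0 |-> 1, z1 |-> 0 shows that the quotient is not trivial. *)
Lemma sq3_one_neq0 : sq3_class Tone != sq3_class Tzero.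
Proof.
apply/eqP => /sq3_classP h.
pose chi := sq3_eval (A := C^o) (fun x : C => x^* ) 1 0.
have /eqP : chi Tone = chi Tzero.
  apply: sq3_eval_cong h.
  - exact: conjCK.
  - exact: rmorphD.
  - by move=> x y; rewrite rmorphM mulrC.
  - by move=> a x; rewrite [LHS]rmorphM.
  - by rewrite mulr0 mul0r scaler0.
  - by rewrite rmorph0 mulr0 mul0r scaler0.
  - by rewrite mul0r mulr0 scaler0.
  - by rewrite mul0r scaler0 addr0 mulrC.
  - by rewrite mulrC.
  - by rewrite mul0r addr0 mul1r rmorph1.
by rewrite /chi /= oner_eq0.
Qed.

HB.instance Definition _ := GRing.Zmodule_isNzRing.Build sq3
  sq3_mulqA sq3_mulq1l sq3_mulq1r sq3_mulqDl sq3_mulqDr sq3_one_neq0.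

Lemma sq3_scaleqA a b x : sq3_scaleq a (sq3_scaleq b x) = sq3_scaleq (a * b) x.
Proof. by rewrite -(sq3_reprK x) !sq3E; exact/sq3_classP/sq3_scaleA. Qed.

Lemma sq3_scaleq1 : left_id 1 sq3_scaleq.
Proof.
by move=> x; rewrite -(sq3_reprK x) sq3E;
  exact/sq3_classP/sq3_scale1.
Qed.

Lemma sq3_scaleqDr : right_distributive sq3_scaleq +%R.
Proof.
move=> a x y; rewrite -(sq3_reprK x) -(sq3_reprK y) [X in sq3_scaleq a X]sq3E.
by rewrite !sq3E [RHS]sq3E; exact/sq3_classP/sq3_scaleDr.
Qed.

Lemma sq3_scaleqDl x : {morph sq3_scaleq^~ x : a b / a + b}.
Proof.
move=> a b; rewrite -(sq3_reprK x) !sq3E [RHS]sq3E.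
exact/sq3_classP/sq3_scaleDl.
Qed.

HB.instance Definition _ := GRing.Zmodule_isLmodule.Build C sq3
  sq3_scaleqA sq3_scaleq1 sq3_scaleqDr sq3_scaleqDl.

Lemma sq3_scaleqAl a (x y : sq3) : a *: (x * y) = (a *: x) * y.
Proof.
rewrite -(sq3_reprK x) -(sq3_reprK y) [_ * _]sq3E [LHS]sq3E.
by rewrite [_ *: _]sq3E [RHS]sq3E; exact/sq3_classP/sq3_scaleAl.
Qed.

HB.instance Definition _ := GRing.Lmodule_isLalgebra.Build C sq3 sq3_scaleqAl.

Lemma sq3_scaleqAr a (x y : sq3) : a *: (x * y) = x * (a *: y).
Proof.
rewrite -(sq3_reprK x) -(sq3_reprK y) [_ * _]sq3E [LHS]sq3E.
by rewrite [_ *: _]sq3E [RHS]sq3E; exact/sq3_classP/sq3_scaleAr.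
Qed.

HB.instance Definition _ := GRing.Lalgebra_isAlgebra.Build C sq3 sq3_scaleqAr.

Definition sq3_z0 : sq3 := sq3_class Tz0.
Definition sq3_z1 : sq3 := sq3_class Tz1.

Local Notation star := sq3_starq.
Local Notation z0 := sq3_z0.
Local Notation z1 := sq3_z1.

Lemma sq3_classD s t : sq3_class s + sq3_class t = sq3_class (s +t t).
Proof. exact: sq3_addqE. Qed.

Lemma sq3_classM s t : sq3_class s * sq3_class t = sq3_class (s *t t).
Proof. exact: sq3_mulqE. Qed.

Lemma sq3_classZ c t : c *: sq3_class t = sq3_class (c :t t).
Proof. exact: sq3_scaleqE. Qed.


Let sq3rE := (sq3_starqE, sq3_classM, sq3_classZ, sq3_classD).

Lemma sq3_starqK : involutive star.
Proof.
by move=> x; rewrite -(sq3_reprK x) !sq3E;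
  exact/sq3_classP/sq3_starK.
Qed.

Lemma sq3_starqD : {morph star : x y / x + y}.
Proof.
move=> x y; rewrite -(sq3_reprK x) -(sq3_reprK y) !sq3rE.
exact/sq3_classP/sq3_starD.
Qed.

Lemma sq3_starqM x y : star (x * y) = star y * star x.
Proof.
rewrite -(sq3_reprK x) -(sq3_reprK y) !sq3rE.
exact/sq3_classP/sq3_starM.
Qed.

Lemma sq3_starqZ a x : star (a *: x) = a^* *: star x.
Proof.
rewrite -(sq3_reprK x) !sq3rE.
exact/sq3_classP/sq3_starZ.
Qed.

Lemma sq3_rel_z0z1 : z0 * z1 = q *: (z1 * z0).
Proof. by rewrite /sq3_z0 /sq3_z1 !sq3rE; exact/sq3_classP/sq3_z0z1. Qed.

Lemma sq3_rel_z0z1s : z0 * star z1 = q *: (star z1 * z0).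
Proof. by rewrite /sq3_z0 /sq3_z1 !sq3rE; exact/sq3_classP/sq3_z0z1s. Qed.

Lemma sq3_rel_z1z0s : z1 * star z0 = q *: (star z0 * z1).
Proof. by rewrite /sq3_z0 /sq3_z1 !sq3rE; exact/sq3_classP/sq3_z1z0s. Qed.

Lemma sq3_rel_z0z0s :
  z0 * star z0 = star z0 * z0 + (q ^- 2 - 1) *: (z1 * star z1).
Proof. by rewrite /sq3_z0 /sq3_z1 !sq3rE; exact/sq3_classP/sq3_z0z0s. Qed.

Lemma sq3_rel_z1z1s : z1 * star z1 = star z1 * z1.
Proof. by rewrite /sq3_z0 /sq3_z1 !sq3rE; exact/sq3_classP/sq3_z1z1s. Qed.

Lemma sq3_rel_sphere : z0 * star z0 + z1 * star z1 = 1.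
Proof. by rewrite /sq3_z0 /sq3_z1 !sq3rE; exact/sq3_classP/sq3_sphere. Qed.

(* The *-endomorphism z0 |-> a z0, z1 |-> b z1; it is well defined, and an
   automorphism, for a and b of modulus 1. *)
Definition sq3_rot (a b : C) (x : sq3) : sq3 :=
  sq3_eval star (a *: z0) (b *: z1) (sq3_repr x).

Section Rot.
Variables a b : C.
Hypotheses (a1 : `|a| = 1) (b1 : `|b| = 1).

Lemma sq3_rot_class t :
  sq3_rot a b (sq3_class t) = sq3_eval star (a *: z0) (b *: z1) t.
Proof.
have aa : a * a^* = 1 by rewrite -normCK a1 expr1n.
have bb : b * b^* = 1 by rewrite -normCK b1 expr1n.
have N c d (x y : sq3) : (c *: x) * (d *: y) = (c * d) *: (x * y).
  by rewrite -scalerAl -scalerAr scalerA.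
apply: sq3_eval_cong (sq3_classK t).
- exact: sq3_starqK.
- exact: sq3_starqD.
- exact: sq3_starqM.
- exact: sq3_starqZ.
- by rewrite !N sq3_rel_z0z1 !scalerA mulrC [b * a]mulrC.
- by rewrite sq3_starqZ !N sq3_rel_z0z1s !scalerA mulrC [_^* * a]mulrC.
- by rewrite sq3_starqZ !N sq3_rel_z1z0s !scalerA mulrC [_^* * b]mulrC.
- by rewrite !sq3_starqZ !N [a^* * a]mulrC aa bb !scale1r; exact: sq3_rel_z0z0s.
- by rewrite !sq3_starqZ !N [b^* * b]mulrC bb !scale1r; exact: sq3_rel_z1z1s.
- by rewrite !sq3_starqZ !N aa bb !scale1r; exact: sq3_rel_sphere.
Qed.

Lemma sq3_rot1 : sq3_rot a b 1 = 1.
Proof. exact: sq3_rot_class. Qed.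

Lemma sq3_rotM : {morph sq3_rot a b : x y / x * y}.
Proof.
move=> x y; rewrite -(sq3_reprK x) -(sq3_reprK y) !sq3rE.
by rewrite !sq3_rot_class.
Qed.

Lemma sq3_rotD : {morph sq3_rot a b : x y / x + y}.
Proof.
move=> x y; rewrite -(sq3_reprK x) -(sq3_reprK y) !sq3rE.
by rewrite !sq3_rot_class.
Qed.

Lemma sq3_rotZ c : {morph sq3_rot a b : x / c *: x}.
Proof.
move=> x; rewrite -(sq3_reprK x) !sq3rE.
by rewrite !sq3_rot_class.
Qed.

End Rot.

(* O(W_q(k,l)): the fixed points of the circle action of weights k, l. *)
Definition teardrop (k l : nat) : {pred sq3} :=
  fun x => `[< forall w : C, `|w| = 1 -> sq3_rot (w ^+ k) (w ^+ l) x = x >].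

Definition spectral_subspace (k l : nat) (n : int) : set sq3 :=
  match n with
  | Posz m => [set x | exists w : 'I_m.+1 -> sq3,
      (forall j, w j \in teardrop k l) /\
      x = \sum_(j < m.+1)
            star z0 ^+ (l * j) * star z1 ^+ (k * (m - j)) * w j]%classic
  | Negz m' => let m := m'.+1 in
    [set x | exists w : 'I_m.+1 -> sq3,
      (forall j, w j \in teardrop k l) /\
      x = \sum_(j < m.+1) z0 ^+ (l * j) * z1 ^+ (k * (m - j)) * w j]%classic
  end.

End QuantumSphere.

Arguments teardrop {C} q k l.
Arguments spectral_subspace {C} q k l.

Section LensSpace.
Variables (R : realType) (q : R[i]) (d k l : nat).

Definition expi (t : R) : R[i] := (cos t +i* sin t)%C.

Lemma norm_expi t : `|expi t| = 1.
Proof. by rewrite normc_def /= cos2Dsin2 sqrtr1. Qed.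

(* The action of the generator of Z/(dlk)Z. *)
Definition lens_gen : sq3 q -> sq3 q :=
  sq3_rot (expi (2 * pi / (d * l)%:R)) (expi (2 * pi / (d * k)%:R)).

Definition lens_fixed : {pred sq3 q} :=
  fun x => `[< forall m : nat, iter m lens_gen x = x >].

Lemma lens_fixedP x : reflect (lens_gen x = x) (x \in lens_fixed).
Proof.
apply: (iffP (asboolP _)) => [/(_ 1%N)//|gx m].
by elim: m => //= m ->.
Qed.

Lemma lens_fixed_subalg : subalg_closed lens_fixed.
Proof.
have h := norm_expi; split.
- by apply/lens_fixedP; exact: sq3_rot1.
- move=> c x y /lens_fixedP gx /lens_fixedP gy; apply/lens_fixedP.
  by rewrite /lens_gen sq3_rotD ?sq3_rotZ //; congr (_ *: _ + _).
- move=> x y /lens_fixedP gx /lens_fixedP gy; apply/lens_fixedP.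
  by rewrite /lens_gen sq3_rotM //; congr (_ * _).
Qed.

(* O(L_q(dlk;k,l)) *)
Definition lens : Type := {x : sq3 q | x \in lens_fixed}.

HB.instance Definition _ := SubChoice.on lens.
HB.instance Definition _ := GRing.SubChoice_isSubAlgebra.Build
  R[i] (sq3 q) lens_fixed lens lens_fixed_subalg.

Definition teardrop_in_lens : {pred lens} :=
  fun x => val x \in teardrop q k l.

Definition lens_grading (n : int) : set lens :=
  [set x : lens | spectral_subspace q k l (d%:Z * n) (val x)]%classic.

Definition lens_coaction : lens -> ctensor lens (OU1 R[i]) :=
  graded_coaction lens_grading.

End LensSpace.

Arguments lens_grading {R} q d k l n.
Arguments lens_coaction {R} q d k l x.
Arguments teardrop_in_lens {R} q d k l.

(* Main.v *)
(* Both algebras are described by weights. For the circle action of weights k, l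
   every element of O(S_q^3) is a finite sum of weight vectors, uniquely so by
   averaging over roots of unity. The generator of Z/(dlk) acts as the root of
   unity exp(2 i pi / (dlk)) of that circle, so the lens space consists of the
   weights divisible by dlk, and the n-th spectral subspace is the weight space
   of weight -kln, as soon as 1 lies in the sum defining it times the opposite
   weight space.
   For the latter write y = star z0, w = star z1 and x = z1 w. Then
   y^m z0^m = p(x) with p(0) = 1, while w^n z1^n = x^n; since p and X^n are
   coprime polynomials, Bezout yields 1 = y^m z0^m f(x) + w^n z1^n g(x), and
   similarly with z0, z1 exchanged with y, w.
   The same identities say that the grading is strong, i.e. that
   1 = sum_i a_i b_i with a_i of degree n and b_i of degree -n, and for a strong
   grading the canonical map has inverse a (x) z^n |-> sum_i a a_i (x) b_i. *)
Require Import Defs.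
From HB Require Import structures.
From mathcomp Require Import all_boot all_order all_algebra.
From mathcomp Require Import ring_quotient ring lra.
From mathcomp Require Import complex boolp classical_sets reals trigo.
Import Order.TTheory GRing.Theory Num.Theory.
Local Open Scope ring_scope.
Local Open Scope complex_scope.

Set Implicit Arguments.
Unset Strict Implicit.
Unset Printing Implicit Defensive.

(** * Linear maps out of O(U(1)) *)

Section PolySum.
Variables (R : nzRingType) (V : zmodType) (psi : nat -> R -> V).
Hypothesis psiD : forall i, {morph psi i : a b / a + b}.

(** The coefficients enter through arbitrary additive maps [psi i], so that the construction can be
    iterated: once over polynomials in z^-1, once over polynomials in z. *)
Definition poly_sum (p : {poly R}) : V := \sum_(i < size p) psi i p`_i.

Let psi0 i : psi i 0 = 0.
Proof. by apply: (addrI (psi i 0)); rewrite -psiD !addr0. Qed.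

Lemma poly_sum_widen n (p : {poly R}) :
  (size p <= n)%N -> poly_sum p = \sum_(i < n) psi i p`_i.
Proof.
move=> le_pn; rewrite /poly_sum (big_ord_widen n (fun i => psi i p`_i)) //.
rewrite big_mkcond; apply: eq_bigr => i _; case: ltnP => // le_pi.
by rewrite nth_default ?psi0.
Qed.

Lemma poly_sumD : {morph poly_sum : p r / p + r}.
Proof.
move=> p r; pose n := maxn (size p) (size r).
rewrite !(@poly_sum_widen n) ?size_polyD ?leq_maxl ?leq_maxr // -big_split /=.
by apply: eq_bigr => i _; rewrite coefD psiD.
Qed.

Lemma poly_sum_mulX p : poly_sum (p * 'X) = \sum_(i < size p) psi i.+1 p`_i.
Proof.
have le_s : (size (p * 'X)%R <= (size p).+1)%N.
  by rewrite (leq_trans (size_polyMleq _ _)) // size_polyX addn2.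
rewrite (poly_sum_widen le_s) big_ord_recl coefMX psi0 add0r.
by apply: eq_bigr => i _; rewrite coefMX.
Qed.

Lemma poly_sumZX a n : poly_sum (a *: 'X^n) = psi n a.
Proof.
have le_s : (size (a *: 'X^n)%R <= n.+1)%N.
  by rewrite (leq_trans (size_scale_leq _ _)) // size_polyXn.
rewrite (poly_sum_widen le_s) big_ord_recr /= coefZ coefXn eqxx mulr1.
rewrite big1 ?add0r // => i _.
by rewrite coefZ coefXn (ltn_eqF (ltn_ord i)) mulr0 psi0.
Qed.

End PolySum.

(** * The algebra of Laurent polynomials and its linear maps *)

Section OU1Theory.
Variable C : fieldType.

Lemma u1_classP (p r : {poly {poly C}}) :
  u1_class p = u1_class r <-> exists s, p - r = s * (1 - 'X * ('X)%:P).
Proof.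
have E : (p - r \in u1_ideal (C := C)) = (u1_class p == u1_class r).
  exact: Quotient.idealrBE.
split=> [/eqP|H]; first by rewrite -E => /asboolP.
by apply/eqP; rewrite -E; apply/asboolP.
Qed.

Lemma u1_classK (h : OU1 C) : u1_class (u1_repr h) = h.
Proof. exact: reprK. Qed.

Section LinearExtension.
Variables (V : lmodType C) (phi : int -> V).

Let inner i := poly_sum (fun j (c : C) => c *: phi (i%:Z - j%:Z)).

Let innerD i : {morph inner i : p r / p + r}.
Proof. by apply: poly_sumD => j a b; exact: scalerDl. Qed.

(* The linear extension of z^n |-> phi n. It has the shape of u1_comul, which is
   u1_lin (fun n => z^n (x) z^n) up to conversion. *)
Definition u1_lin (h : OU1 C) : V :=
  let p := u1_repr h in
  \sum_(i < size p) \sum_(j < size p`_i) p`_i`_j *: phi (i%:Z - j%:Z).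

(** Multiplying by the inner variable z^-1 while raising the outer index leaves every difference i -
    j unchanged. *)
Let inner_mulX i p : inner i.+1 (p * 'X) = inner i p.
Proof.
rewrite /inner poly_sum_mulX; last by move=> j a b; exact: scalerDl.
by apply: eq_bigr => j _; rewrite !intS opprD addrACA subrr add0r.
Qed.

(** Two representatives differ by r - r z z^-1. The factor z raises the outer index and z^-1 the
    inner one, so by [inner_mulX] the two contributions cancel. *)
Lemma u1_lin_class p : u1_lin (u1_class p) = poly_sum inner p.
Proof.
have /u1_classP[r /eqP] : u1_class (u1_repr (u1_class p)) = u1_class p.
  exact: u1_classK.
rewrite subr_eq mulrBr mulr1 => /eqP E.
transitivity (poly_sum inner (u1_repr (u1_class p))); first by [].
rewrite E poly_sumD // addrC -[RHS]addr0; congr (_ + _).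
(* The outer variable is moved to the far right, the shape that [poly_sum_mulX] expects. *)
have -> : r - r * ('X * ('X)%:P) = r + ((- 'X)%:P * r) * 'X.
  rewrite rmorphN /= !mulNr; congr (_ - _).
  by rewrite [LHS]mulrCA [RHS]mulrC [_%:P * _]mulrC.
have sz : size ((- 'X)%:P * r) = size r.
  by rewrite size_Cmul // oppr_eq0 polyX_eq0.
rewrite poly_sumD // poly_sum_mulX // sz -big_split big1 //= => i _.
rewrite coefCM mulNr mulrC -inner_mulX -innerD subrr.
by rewrite /inner /poly_sum size_poly0 big_ord0.
Qed.

Lemma u1_linD : {morph u1_lin : g h / g + h}.
Proof.
move=> g h; rewrite -(u1_classK g) -(u1_classK h) -u1_classD !u1_lin_class.
exact: poly_sumD.
Qed.

Lemma u1_linZ c h : u1_lin (c *: h) = c *: u1_lin h.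
Proof.
rewrite -{1}(u1_classK h) -[_ *: _]u1_classM u1_lin_class mul_polyC.
rewrite (@poly_sum_widen _ _ _ _ (size (u1_repr h))) ?size_scale_leq //.
rewrite [u1_lin h]/u1_lin scaler_sumr; apply: eq_bigr => i _.
rewrite coefZ mul_polyC.
rewrite /inner (@poly_sum_widen _ _ _ _ (size (u1_repr h)`_i)) ?size_scale_leq //.
  by rewrite scaler_sumr; apply: eq_bigr => j _; rewrite coefZ scalerA.
by move=> j a b; exact: scalerDl.
Qed.

End LinearExtension.

Local Notation u := (u1_pow C).

Definition u1_gen : OU1 C := u1_class 'X.
Definition u1_inv : OU1 C := u1_class ('X)%:P.

Lemma u1_genV : u1_gen * u1_inv = 1.
Proof.
rewrite -u1_classM -u1_class1; apply/esym/u1_classP.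
by exists 1; rewrite mul1r.
Qed.

Lemma u1_powS n : u (n + 1) = u1_gen * u n.
Proof.
case: n => [n|[|n]]; first by rewrite -PoszD addn1 /= exprS.
  by rewrite /= expr1 u1_genV.
have -> : Negz n.+1 + 1 = Negz n.
  by rewrite !NegzE [in LHS]intS opprD addrAC addNr add0r.
by rewrite /= [_ ^+ n.+2]exprS mulrA u1_genV mul1r.
Qed.

Lemma u1_powP n : u (n - 1) = u1_inv * u n.
Proof.
by rewrite -[n in RHS](subrK 1) u1_powS mulrA [u1_inv * _]mulrC u1_genV mul1r.
Qed.

Lemma u1_powD m n : u (m + n) = u m * u n.
Proof.
elim/int_ind: m => [|m IHm|m IHm]; first by rewrite add0r mul1r.
  rewrite intS [1 + _]addrC addrAC !u1_powS IHm. exact: mulrA.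
rewrite intS opprD [-1 + _]addrC addrAC !u1_powP IHm. exact: mulrA.
Qed.

Lemma u1_pow_class (i j : nat) : u (i%:Z - j%:Z) = u1_class ('X^i * ('X^j)%:P).
Proof.
have cX : u1_class (C := C) ('X^i) = u i.
  elim: i => [|i IHi]; first by rewrite u1_class1.
  by rewrite exprS u1_classM IHi -addn1 PoszD u1_powS.
have cY : u1_class (C := C) ('X^j)%:P = u (- j%:Z).
  elim: j => [|j IHj]; first by rewrite u1_class1.
  by rewrite exprS polyCM u1_classM IHj intS opprD [-1 + _]addrC u1_powP.
by rewrite u1_classM cX cY u1_powD.
Qed.

Lemma u1_lin_pow (V : lmodType C) (phi : int -> V) n : u1_lin phi (u n) = phi n.
Proof.
have E (i j : nat) : u1_lin phi (u (i%:Z - j%:Z)) = phi (i%:Z - j%:Z).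
  rewrite u1_pow_class u1_lin_class mulrC mul_polyC poly_sumZX; last first.
    by move=> k; apply: poly_sumD => m a b; exact: scalerDl.
  rewrite -[X in poly_sum _ X]scale1r poly_sumZX ?scale1r //.
  by move=> m a b; exact: scalerDl.
case: n => n; first by rewrite -[Posz n]subr0; exact: (E n 0).
by rewrite NegzE -[- _]add0r; exact: (E 0 n.+1).
Qed.

Lemma u1_lin_comp (V W : lmodType C) (f : V -> W) (phi : int -> V) h :
  f 0 = 0 -> {morph f : x y / x + y} -> (forall c x, f (c *: x) = c *: f x) ->
  f (u1_lin phi h) = u1_lin (f \o phi) h.
Proof.
move=> f0 fD fZ; rewrite /u1_lin (big_morph f fD f0); apply: eq_bigr => i _.
by rewrite (big_morph f fD f0); apply: eq_bigr => j _; rewrite fZ.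
Qed.

(** Expanding the representative into monomials shows that the powers of z span O(U(1)); this is the
    form in which spanning is used. *)
Lemma u1_lin_id h : u1_lin u h = h.
Proof.
rewrite -[RHS]u1_classK -[u1_repr h in RHS]coefK poly_def.
have c0 : u1_class (C := C) 0 = 0.
  by apply: (addrI (u1_class 0)); rewrite -u1_classD !addr0.
rewrite (big_morph _ (@u1_classD C) c0); apply: eq_bigr => i _.
rewrite -mul_polyC -[(u1_repr h)`_i in RHS]coefK poly_def.
rewrite (big_morph polyC (@polyCD _) (erefl _)) mulr_suml.
rewrite (big_morph _ (@u1_classD C) c0); apply: eq_bigr => j _.
rewrite u1_pow_class -[_ *: _]u1_classM -[in RHS]mul_polyC polyCM.
by congr (u1_class _); rewrite -mulrA; congr (_ * _); exact: mulrC.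
Qed.

(** Evaluation at z = z^-1 = 1 adds up all coefficients. In this form additivity and [u1_lin_pow]
    apply to the counit. *)
Lemma u1_counitE h : u1_counit h = u1_lin (fun=> 1 : C^o) h.
Proof.
rewrite /u1_counit (horner_coef (u1_repr h)) horner_sum; apply: eq_bigr => i _.
rewrite expr1n mulr1 horner_coef; apply: eq_bigr => j _.
by rewrite expr1n.
Qed.

End OU1Theory.
(** * Strongly graded algebras *)

Section CtensorTheory.
Variables (C : comNzRingType) (M N : lmodType C).

(** Exactly the conditions under which [clift f] is well defined. The target is only an abelian
    group, hence the balancing condition instead of homogeneity. *)
Definition cbilinear (V : zmodType) (f : M -> N -> V) : Prop :=
  [/\ forall x x' y, f (x + x') y = f x y + f x' y,
      forall x y y', f x (y + y') = f x y + f x y'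
    & forall x c y, f (c *: x) y = f x (c *: y)].

Lemma cpureDl (x x' : M) (y : N) : cpure (x + x') y = cpure x y + cpure x' y.
Proof. exact: pureDl. Qed.

Lemma cpureDr (x : M) (y y' : N) : cpure x (y + y') = cpure x y + cpure x y'.
Proof. exact: pureDr. Qed.

Lemma cpureZl c (x : M) (y : N) : cpure (c *: x) y = c *: cpure x y.
Proof. by rewrite -ctensor_scale_pure. Qed.

Lemma cpureZr c (x : M) (y : N) : cpure x (c *: y) = c *: cpure x y.
Proof. by rewrite -cpureZl; apply/esym; exact: pure_balance. Qed.

Lemma cpure0l (y : N) : cpure (0 : M) y = 0.
Proof. by rewrite -(scale0r (0 : M)) cpureZl scale0r. Qed.

Section Lift.
Variables (V : zmodType) (f : M -> N -> V).
Hypothesis f_bil : cbilinear f.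

Lemma clift_pure x y : clift f (cpure x y) = f x y.
Proof. by case: f_bil => fl fr fb; exact: tensor_lift_pure. Qed.

Lemma cliftD : {morph clift f : s t / s + t}.
Proof. by case: f_bil => fl fr fb s t; exact: tensor_liftD. Qed.

Lemma clift0 : clift f 0 = 0.
Proof. by apply: (addrI (clift f 0)); rewrite -cliftD !addr0. Qed.

Lemma clift_sum I (r : seq I) (a : I -> M) (b : I -> N) :
  clift f (\sum_(i <- r) cpure (a i) (b i)) = \sum_(i <- r) f (a i) (b i).
Proof.
rewrite (big_morph _ cliftD clift0); apply: eq_bigr => i _.
exact: clift_pure.
Qed.

End Lift.

Lemma cliftZ (V : lmodType C) (f : M -> N -> V) c t :
  cbilinear f -> (forall x y, f (c *: x) y = c *: f x y) ->
  clift f (c *: t) = c *: clift f t.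
Proof.
move=> f_bil fZ; elim/ctensor_ind: t => [|s t IHs IHt|x y].
- by rewrite scaler0 clift0 // scaler0.
- by rewrite scalerDr !cliftD // IHs IHt scalerDr.
- by rewrite -cpureZl !clift_pure.
Qed.

Lemma eq_clift (V : zmodType) (f g : M -> N -> V) t :
  (forall x y, f x y = g x y) -> clift f t = clift g t.
Proof. by move=> fg; apply: eq_bigr => p _; exact: fg. Qed.

Lemma clift_addf (V : zmodType) (f g : M -> N -> V) t :
  clift (fun x y => f x y + g x y) t = clift f t + clift g t.
Proof. exact: big_split. Qed.

End CtensorTheory.

(** Induction principle reducing statements about A (x) O(U(1)) to tensors x (x) z^n; the scalars of
    a Laurent polynomial are absorbed into x. *)
Lemma ctensor_u1_span (C : fieldType) (M : lmodType C)
    (P : ctensor M (OU1 C) -> Prop) :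
  P 0 -> (forall s t, P s -> P t -> P (s + t)) ->
  (forall x n, P (cpure x (u1_pow C n))) -> forall t, P t.
Proof.
move=> P0 PD Pp; elim/ctensor_ind => // x h; rewrite -(u1_lin_id h).
have cD : {morph (cpure x : OU1 C -> ctensor M (OU1 C)) : g k / g + k}.
  by move=> g k; exact: cpureDr.
have c0 : cpure x (0 : OU1 C) = 0 by apply: (addrI (cpure x 0)); rewrite -cD !addr0.
rewrite (u1_lin_comp _ _ c0 cD); last by move=> c g; exact: cpureZr.
rewrite /u1_lin; elim/big_ind: _ => // i _; elim/big_ind: _ => // j _ /=.
by rewrite -cpureZl; exact: Pp.
Qed.

(** * The coaction of a strong Z-grading *)

Section GradedAlgebra.
Variables (C : fieldType) (A : algType C) (G : int -> set A).
Hypothesis G_sub : forall n c x y, G n x -> G n y -> G n (c *: x + y).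
Hypothesis G_zero : forall n, G n 0.
Hypothesis G_one : G 0 1.
Hypothesis G_mul : forall m n x y, G m x -> G n y -> G (m + n) (x * y).
Hypothesis G_dec : forall x, exists s, decomposes G x s.
Hypothesis G_direct : forall s : seq (int * A),
  (forall p, p \in s -> G p.1 p.2) -> \sum_(p <- s) p.2 = 0 ->
  forall n, \sum_(p <- s | p.1 == n) p.2 = 0.
Hypothesis G_strong : forall n, exists2 s : seq (A * A),
  (forall p, p \in s -> G n p.1 /\ G (- n) p.2) & \sum_(p <- s) p.1 * p.2 = 1.

Local Notation H := (OU1 C).
Local Notation u := (u1_pow C).
Local Notation delta := (graded_coaction G).

(** After grouping by degree, the additive map [F n] acts on the component of degree n, which
    vanishes. This serves both the well-definedness of the coaction and the injectivity of the
    canonical map. *)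
Lemma sum_homogeneous0 (V : zmodType) (F : int -> A -> V) (s : seq (int * A)) :
  (forall n, {morph F n : x y / x + y}) ->
  (forall n, \sum_(p <- s | p.1 == n) p.2 = 0) ->
  \sum_(p <- s) F p.1 p.2 = 0.
Proof.
move=> FD s0; pose r := undup (map fst s).
have F0 n : F n 0 = 0 by apply: (addrI (F n 0)); rewrite -FD !addr0.
(* The degrees in [r] are pairwise distinct, so the inner sum has exactly one term. *)
transitivity (\sum_(p <- s) \sum_(n <- r | n == p.1) F n p.2).
  rewrite !big_seq; apply: eq_bigr => p ps.
  rewrite -big_filter filter_pred1_uniq ?undup_uniq ?big_seq1 //.
  by rewrite mem_undup map_f.
rewrite (exchange_big_dep predT) //= big1 // => n _.
rewrite (eq_bigl (fun p => p.1 == n)); last by move=> p; rewrite eq_sym.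
by rewrite -(big_morph _ (FD n) (F0 n)) s0 F0.
Qed.

(** The chosen decomposition and [s] differ by a family of homogeneous elements with sum zero. By
    directness it vanishes degree by degree, so [sum_homogeneous0] applies. *)
Lemma graded_coactionE s x : decomposes G x s ->
  delta x = \sum_(p <- s) cpure p.2 (u (- p.1)).
Proof.
move=> [sG sx]; rewrite /graded_coaction.
case: xgetP => [t _ [tG tx]|no]; last by case: (no s).
apply/eqP; rewrite -subr_eq0 -sumrN.
have -> : \sum_(p <- s) - cpure p.2 (u (- p.1)) =
          \sum_(p <- [seq (p.1, - p.2) | p <- s]) cpure p.2 (u (- p.1)).
  rewrite big_map; apply: eq_bigr => p _ /=.
  by rewrite -[- p.2]scaleN1r cpureZl scaleN1r.
rewrite -big_cat; apply/eqP.
apply: (sum_homogeneous0 (F := fun n x => cpure x (u (- n)))) => [n y z|].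
  exact: cpureDl.
apply: G_direct => [p|].
  rewrite mem_cat => /orP[/tG//|/mapP[r /sG Gr ->]] /=.
  by rewrite -scaleN1r -[_ *: _]addr0; exact: G_sub.
by rewrite big_cat big_map /= sumrN -sx -tx subrr.
Qed.

Lemma graded_coaction_homog n x : G n x -> delta x = cpure x (u (- n)).
Proof.
move=> Gx; rewrite (@graded_coactionE [:: (n, x)]) ?big_seq1 //.
by split; [move=> p; rewrite inE => /eqP ->|rewrite big_seq1].
Qed.

Lemma graded_coactionD : {morph delta : x y / x + y}.
Proof.
move=> x y; have [s sx] := G_dec x; have [t ty] := G_dec y.
rewrite (graded_coactionE sx) (graded_coactionE ty) -big_cat.
apply: graded_coactionE; case: sx ty => sG -> [tG ->].
split; last by rewrite big_cat.
by move=> p; rewrite mem_cat => /orP[/sG|/tG].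
Qed.

Lemma graded_ind (P : A -> Prop) :
  P 0 -> (forall x y, P x -> P y -> P (x + y)) ->
  (forall n x, G n x -> P x) -> forall x, P x.
Proof.
move=> P0 PD PG x; have [s [sG ->]] := G_dec x.
by rewrite big_seq; elim/big_ind: _ => // p /sG; exact: PG.
Qed.

Lemma graded_coaction0 : delta 0 = 0.
Proof. by apply: (addrI (delta 0)); rewrite -graded_coactionD !addr0. Qed.

Lemma graded_coactionZ c x : delta (c *: x) = c *: delta x.
Proof.
elim/graded_ind: x => [|x y IHx IHy|n x Gx].
- by rewrite scaler0 graded_coaction0 scaler0.
- by rewrite scalerDr !graded_coactionD IHx IHy scalerDr.
- rewrite !(@graded_coaction_homog n) ?cpureZl //.
  by rewrite -[_ *: _]addr0; exact: G_sub.
Qed.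

Lemma ctensor_mul_bilinear (t : ctensor A H) :
  cbilinear (fun a h => clift (fun a' h' => cpure (a * a') (h * h')) t).
Proof.
split=> [x x' y|x y y'|x c y].
- rewrite -clift_addf; apply: eq_clift => a h.
  by rewrite mulrDl cpureDl.
- rewrite -clift_addf; apply: eq_clift => a h.
  by rewrite mulrDl cpureDr.
- by apply: eq_clift => a h; rewrite -!scalerAl cpureZl cpureZr.
Qed.

Lemma ctensor_mul_inner (a : A) (h : H) :
  cbilinear (fun a' h' => cpure (a * a') (h * h')).
Proof.
split=> [x x' y|x y y'|x c y].
- by rewrite mulrDr cpureDl.
- by rewrite mulrDr cpureDr.
- by rewrite -scalerAr cpureZl [h * (c *: y)]mulrC -scalerAl cpureZr [y * h]mulrC.
Qed.

Lemma ctensor_mulDl (t s s' : ctensor A H) :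
  ctensor_mul (s + s') t = ctensor_mul s t + ctensor_mul s' t.
Proof. exact: cliftD (ctensor_mul_bilinear t) s s'. Qed.

Lemma ctensor_mulDr (t s s' : ctensor A H) :
  ctensor_mul t (s + s') = ctensor_mul t s + ctensor_mul t s'.
Proof.
rewrite /ctensor_mul -clift_addf; apply: eq_clift => a h.
exact: cliftD (ctensor_mul_inner a h) s s'.
Qed.

Lemma ctensor_mul_pure (a b : A) (g h : H) :
  ctensor_mul (cpure a g) (cpure b h) = cpure (a * b) (g * h).
Proof.
rewrite /ctensor_mul (clift_pure (ctensor_mul_bilinear _)).
exact: clift_pure (ctensor_mul_inner _ _) _ _.
Qed.

Lemma graded_coactionM x y : delta (x * y) = ctensor_mul (delta x) (delta y).
Proof.
have mul0t t : ctensor_mul (0 : ctensor A H) t = 0.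
  exact: clift0 (ctensor_mul_bilinear t).
have mult0 t : ctensor_mul t (0 : ctensor A H) = 0.
  by apply: (addrI (ctensor_mul t 0)); rewrite -ctensor_mulDr !addr0.
elim/graded_ind: x => [|x x' IHx IHx'|m x Gx].
- by rewrite mul0r graded_coaction0 mul0t.
- by rewrite mulrDl !graded_coactionD IHx IHx' ctensor_mulDl.
elim/graded_ind: y => [|y y' IHy IHy'|n y Gy].
- by rewrite mulr0 graded_coaction0 mult0.
- by rewrite mulrDr !graded_coactionD IHy IHy' ctensor_mulDr.
rewrite (graded_coaction_homog Gx) (graded_coaction_homog Gy) ctensor_mul_pure.
by rewrite (graded_coaction_homog (G_mul Gx Gy)) opprD u1_powD.
Qed.

Lemma delta_l_bilinear : cbilinear (fun a (h : H) => cpure (delta a) h).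
Proof.
split=> [x x' y|x y y'|x c y].
- by rewrite graded_coactionD cpureDl.
- by rewrite cpureDr.
- by rewrite graded_coactionZ cpureZl cpureZr.
Qed.

Lemma clift_comul (a : A) (h : H) :
  clift (fun h1 h2 => cpure (cpure a h1) h2) (u1_comul h) =
  u1_lin (fun n => cpure (cpure a (u n)) (u n)) h.
Proof.
have bil : cbilinear (fun h1 h2 : H => cpure (cpure a h1) h2).
  split=> [x x' y|x y y'|x c y].
  - by rewrite cpureDr cpureDl.
  - by rewrite cpureDr.
  - by rewrite cpureZr cpureZl cpureZr.
transitivity (clift (fun h1 h2 => cpure (cpure a h1) h2)
  (u1_lin (fun n => cpure (u n) (u n)) h)); first by [].
rewrite (@u1_lin_comp _ _ _ (clift (fun h1 h2 => cpure (cpure a h1) h2))).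
- rewrite /u1_lin; apply: eq_bigr => i _; apply: eq_bigr => j _.
  by rewrite /= clift_pure.
- exact: clift0.
- exact: cliftD.
- by move=> c t; apply: cliftZ => // x y; rewrite cpureZr cpureZl.
Qed.

Lemma delta_r_bilinear :
  cbilinear (fun (a : A) (h : H) =>
    clift (fun h1 h2 => cpure (cpure a h1) h2) (u1_comul h)).
Proof.
split=> [x x' y|x y y'|x c y].
- rewrite -clift_addf; apply: eq_clift => a h.
  by rewrite !cpureDl.
- by rewrite !clift_comul u1_linD.
- rewrite [in RHS]clift_comul u1_linZ -clift_comul.
  rewrite !clift_comul /u1_lin scaler_sumr; apply: eq_bigr => i _.
  rewrite scaler_sumr; apply: eq_bigr => j _.
  by rewrite !cpureZl !scalerA mulrC.
Qed.

Lemma scale_u1_bilinear (phi : int -> C^o) :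
  cbilinear (fun (a : A) (h : H) => (u1_lin phi h : C) *: a).
Proof.
split=> [x x' y|x y y'|x c y].
- by rewrite scalerDr.
- by rewrite u1_linD scalerDl.
- by rewrite u1_linZ scalerA mulrC.
Qed.

Lemma graded_comodule_algebra : is_comodule_algebra delta.
Proof.
split.
- by move=> c x y; rewrite graded_coactionD graded_coactionZ.
- by rewrite (graded_coaction_homog G_one) oppr0.
- exact: graded_coactionM.
- move=> x; have [s sx] := G_dec x; rewrite (graded_coactionE sx).
  rewrite (clift_sum delta_l_bilinear) (clift_sum delta_r_bilinear).
  rewrite !big_seq; apply: eq_bigr => p /(proj1 sx) Gp.
  by rewrite (graded_coaction_homog Gp) clift_comul u1_lin_pow.
- move=> x; have [s sx] := G_dec x; rewrite (graded_coactionE sx).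
  rewrite (eq_clift (g := fun a h => (u1_lin (fun=> 1 : C^o) h : C) *: a)).
    rewrite (clift_sum (scale_u1_bilinear _)) [RHS](proj2 sx).
    by apply: eq_bigr => p _; rewrite u1_lin_pow scale1r.
  by move=> a h; rewrite u1_counitE.
Qed.

(** The map A (x) O(U(1)) -> A that reads off the coefficient of z^n. *)
Definition graded_coef n (t : ctensor A H) : A :=
  clift (fun a h => (u1_lin (fun m => (m == n)%:R : C^o) h : C) *: a) t.

Lemma graded_coef_sum I (r : seq I) (a : I -> A) (k : I -> int) n :
  graded_coef n (\sum_(i <- r) cpure (a i) (u (k i))) =
  \sum_(i <- r | k i == n) a i.
Proof.
rewrite /graded_coef (clift_sum (scale_u1_bilinear _)) [RHS]big_mkcond.
apply: eq_bigr => i _; rewrite u1_lin_pow.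
by case: (k i == n); rewrite ?scale1r ?scale0r.
Qed.

(** Comparing coefficients of z^0 in delta x = x (x) 1 shows that x is the sum of its components of
    degree 0. *)
Lemma coinvariants_graded x : (x \in coinvariants delta) <-> G 0 x.
Proof.
split; last by move=> Gx; apply/asboolP; rewrite (graded_coaction_homog Gx) oppr0.
case/asboolP; have [s sx] := G_dec x; rewrite (graded_coactionE sx).
move/(congr1 (graded_coef 0)); rewrite graded_coef_sum.
rewrite /graded_coef (clift_pure (scale_u1_bilinear _)) (@u1_lin_pow _ _ _ 0).
rewrite eqxx scale1r => <-; rewrite big_seq_cond.
elim/big_ind: _ => [//|y z Gy Gz|p /andP[/(proj1 sx) Gp]].
  by rewrite -[y]scale1r; exact: G_sub.
by rewrite oppr_eq0 => /eqP p0; rewrite -p0.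
Qed.

(** * Bijectivity of the canonical map *)

Section CanonicalMap.
Variable B : {pred A}.
Hypothesis BG : forall x, (x \in B) <-> G 0 x.

Local Notation can := (@canonical_map C A B delta).
Local Notation tpure := (@pure {b : A | b \in B} A A
  (fun x b => x * val b) (fun b y => val b * y)).

Lemma can_inner_bilinear (x : A) : cbilinear (fun a (h : H) => cpure (x * a) h).
Proof.
split=> [a a' h|a h h'|a c h].
- by rewrite mulrDr cpureDl.
- by rewrite cpureDr.
- by rewrite -scalerAr cpureZl cpureZr.
Qed.

Let canf x y : ctensor A H := clift (fun a h => cpure (x * a) h) (delta y).

Let canfDl x x' y : canf (x + x') y = canf x y + canf x' y.
Proof.
by rewrite /canf -clift_addf; apply: eq_clift => a h; rewrite mulrDl cpureDl.
Qed.

Let canfDr x y y' : canf x (y + y') = canf x y + canf x y'.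
Proof. by rewrite /canf graded_coactionD (cliftD (can_inner_bilinear x)). Qed.

Let canf_homog x n y : G n y -> canf x y = cpure (x * y) (u (- n)).
Proof.
move=> Gy; rewrite /canf (graded_coaction_homog Gy).
exact: clift_pure (can_inner_bilinear x) _ _.
Qed.

Let canf0 x : canf x 0 = 0.
Proof. by apply: (addrI (canf x 0)); rewrite -canfDr !addr0. Qed.

Let canf_bal x (b : {b : A | b \in B}) y : canf (x * val b) y = canf x (val b * y).
Proof.
have Gb : G 0 (val b) by apply/BG; exact: valP.
elim/graded_ind: y => [|y y' IHy IHy'|n y Gy].
- by rewrite mulr0 !canf0.
- by rewrite mulrDr !canfDr IHy IHy'.
- rewrite (canf_homog _ Gy) (@canf_homog _ n) ?mulrA //.
  by rewrite -[n]add0r; exact: G_mul.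
Qed.

Lemma canonical_mapD : {morph can : s t / s + t}.
Proof. by move=> s t; exact: (tensor_liftD canfDl canfDr canf_bal). Qed.

Lemma canonical_map_pure x n y :
  G n y -> can (tpure x y) = cpure (x * y) (u (- n)).
Proof.
move=> Gy; rewrite -(canf_homog _ Gy).
exact: (tensor_lift_pure canfDl canfDr canf_bal).
Qed.

Let can0 : can 0 = 0.
Proof. by apply: (addrI (can 0)); rewrite -canonical_mapD !addr0. Qed.

Lemma tpureDl y : {morph (fun x => tpure x y) : x x' / x + x'}.
Proof. by move=> x x'; exact: pureDl. Qed.

Lemma tpureDr x : {morph tpure x : y y' / y + y'}.
Proof. by move=> y y'; exact: pureDr. Qed.

Lemma tpure0r x : tpure x 0 = 0.
Proof. by apply: (addrI (tpure x 0)); rewrite -tpureDr !addr0. Qed.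

Lemma canonical_map_surj t : exists s, can s = t.
Proof.
elim/ctensor_u1_span: t => [|_ _ [s <-] [t <-]|x n].
- by exists 0.
- by exists (s + t); rewrite canonical_mapD.
have [r rG r1] := G_strong n.
(* Each [p.2] has degree -n, so the coaction sends it to [p.2] (x) z^n; the products [p.1 * p.2]
   then add up to 1. *)
exists (\sum_(p <- r) tpure (x * p.1) p.2).
rewrite (big_morph _ canonical_mapD can0) -[x in RHS]mulr1 -r1 mulr_sumr.
rewrite (big_morph (fun y => cpure y (u n))
  (fun a b => cpureDl a b _) (cpure0l _ _)).
rewrite !big_seq; apply: eq_bigr => p /rG[_ Gp].
by rewrite (canonical_map_pure _ Gp) opprK mulrA.
Qed.

(** Only the second factor is split into homogeneous parts, since the canonical map applies the
    coaction to that factor alone. *)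
Lemma tensor_over_homog (t : tensor_over B) :
  exists2 s : seq (int * (A * A)), (forall p, p \in s -> G p.1 p.2.2)
    & t = \sum_(p <- s) tpure p.2.1 p.2.2.
Proof.
rewrite (tensor_sum t); elim: (repr t) => [|[x y] r [s sG IHs]].
  by exists [::]; rewrite ?big_nil.
have [s' [s'G ->]] := G_dec y.
exists ([seq (p.1, (x, p.2)) | p <- s'] ++ s).
  by move=> p; rewrite mem_cat => /orP[/mapP[p' /s'G Gp ->]|/sG].
rewrite big_cons big_cat big_map IHs; congr (_ + _).
exact: (big_morph (tpure x) (tpureDr x) (tpure0r x)).
Qed.

(* For y and b_i of degree n and a_i of degree -n, y a_i is in B, hence
   x (x) y = sum_i x (x) y a_i b_i = sum_i x y a_i (x) b_i depends on x y only. *)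
Lemma canonical_map_ker t : can t = 0 -> t = 0.
Proof.
have [s sG ->] := tensor_over_homog t.
rewrite (big_morph _ canonical_mapD can0) big_seq.
under eq_bigr => p ps do rewrite (canonical_map_pure _ (sG p ps)).
rewrite -big_seq => /(congr1 (graded_coef _)) can_s.
(* The coefficient of z^(-n) in the image is the sum of the products x y over the tensors with y of
   degree n. *)
have xy0 n : \sum_(p <- [seq (p.1, p.2.1 * p.2.2) | p <- s] | p.1 == n) p.2 = 0.
  rewrite big_map; have := can_s (- n).
  rewrite graded_coef_sum /graded_coef clift0; last exact: scale_u1_bilinear.
  by rewrite (eq_bigl (fun p => p.1 == n)) // => p; rewrite /= eqr_opp.
have /choice[r rP] n : exists r : seq (A * A),
    (forall p, p \in r -> G (- n) p.1 /\ G n p.2) /\ \sum_(p <- r) p.1 * p.2 = 1.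
  by have [r rG r1] := G_strong (- n); exists r; rewrite opprK in rG.
pose F n x : tensor_over B := \sum_(p <- r n) tpure (x * p.1) p.2.
have FD n : {morph F n : x y / x + y}.
  move=> x y; rewrite /F -big_split; apply: eq_bigr => p _ /=.
  by rewrite mulrDl tpureDl.
(* Zero is rewritten as the sum of [F n (x y)], so that the two sums can be compared term by
   term. *)
rewrite -[RHS](sum_homogeneous0 FD xy0) big_map !big_seq; apply: eq_bigr => p ps /=.
have [rG r1] := rP p.1.
rewrite -[p.2.2 in LHS]mulr1 -r1 mulr_sumr.
rewrite (big_morph (tpure p.2.1) (tpureDr _) (tpure0r _)) /F !big_seq.
apply: eq_bigr => a /rG[Ga1 Ga2]; rewrite mulrA.
have ya_B : p.2.2 * a.1 \in B.
  by apply/BG; rewrite -(subrr p.1); apply: G_mul => //; exact: sG.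
transitivity (tpure (p.2.1 * (p.2.2 * a.1)) a.2); last by rewrite mulrA.
by rewrite -[p.2.2 * a.1]/(val (exist (fun b => b \in B) _ ya_B)) pure_balance.
Qed.

Theorem strongly_graded_principal_bundle : quantum_principal_U1_bundle delta B.
Proof.
split; first exact: graded_comodule_algebra.
  by move=> x; apply/idP/idP => [/coinvariants_graded/BG|/BG/coinvariants_graded].
have /choice[g canK] t := canonical_map_surj t.
(* The choice [g] is a right inverse; it is also a left inverse because g (can s) - s lies in the
   kernel. *)
exists g => // s; apply/eqP; rewrite -subr_eq0; apply/eqP/canonical_map_ker.
by apply: (addIr (can s)); rewrite -canonical_mapD subrK add0r canK.
Qed.

End CanonicalMap.
End GradedAlgebra.

(** * Weights of the quantum sphere *)

Section RootOfUnityAverage.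
Variables (F : fieldType) (M : nat) (z : F).
Hypothesis z_prim : M.-primitive_root z.

Lemma prim_root_exprz_eq1 (e : int) : (z ^ e == 1) = (M %| e)%Z.
Proof.
have E (n : nat) : (z ^+ n == 1) = (M %| n)%N by rewrite -(prim_order_dvd z_prim).
case: e => n; first by rewrite -exprnP E.
by rewrite NegzE -exprnN invr_eq1 E dvdzE abszN.
Qed.

(** A geometric sum: multiplied by z^e - 1 it telescopes to z^(eM) - 1 = 0. *)
Lemma sum_prim_root (e : int) :
  \sum_(j < M) (z ^+ j) ^ e = if (M %| e)%Z then M%:R else 0.
Proof.
under eq_bigr => j _ do rewrite exprnP exprzAC -exprnP.
rewrite -prim_root_exprz_eq1; case: eqP => [->|/eqP ze].
  under eq_bigr do rewrite expr1n.
  by rewrite sumr_const card_ord.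
apply: (mulfI (x := z ^ e - 1)); first by rewrite subr_eq0.
rewrite -subrX1 mulr0 exprnP exprzAC -exprnP (prim_expr_order z_prim).
by rewrite exp1rz subrr.
Qed.

(** Averaging over the M-th roots of unity is the projection onto the weights congruent to n modulo
    M. *)
Lemma root_average (V : lmodType F) (s : seq (int * V)) (n : int) :
  M%:R^-1 *: (\sum_(j < M) \sum_(p <- s) (z ^+ j) ^ (p.1 - n) *: p.2) =
  \sum_(p <- s | (M %| p.1 - n)%Z) p.2.
Proof.
rewrite exchange_big scaler_sumr [RHS]big_mkcond; apply: eq_bigr => p _ /=.
rewrite -scaler_suml sum_prim_root scalerA; case: ifP => _.
  by rewrite mulVf ?scale1r ?(prim_root_natf_neq0 z_prim).
by rewrite mulr0 scale0r.
Qed.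

End RootOfUnityAverage.

(** * Powers of skew-commuting elements and Bezout identities *)

Section CommutationBezout.
Variables (F : fieldType) (A : algType F).

(** Moving u past x rescales x by c, so r is p(cX). Later steps use only its constant term. *)
Lemma horner_alg_swap (x u : A) c p : x * u = c *: (u * x) ->
  exists2 r : {poly F}, r.[0] = p.[0] & horner_alg x p * u = u * horner_alg x r.
Proof.
move=> xu; elim/poly_ind: p => [|p a [r _ IHp]].
  by exists 0; rewrite // rmorph0 mul0r mulr0.
exists (c *: (r * 'X) + a%:P).
  by rewrite !hornerD !hornerC hornerZ !hornerMX !mulr0.
rewrite !rmorphD /= linearZ /= !rmorphM /= !horner_algX !horner_algC mulrDl mulrDr.
rewrite -mulrA xu -scalerAr [_ * (u * x)]mulrA IHp.
by rewrite -!scalerAl !mul1r -!scalerAr mulr1 mulrA.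
Qed.

(** By induction v (v^m u^m) u = v p(x) u = v u r(x) = (1 - b x) r(x), which keeps the constant term
    1. *)
Lemma exprM_horner_alg (x u v : A) c b m :
  x * u = c *: (u * x) -> v * u = 1 - b *: x ->
  exists2 p : {poly F}, p.[0] = 1 & v ^+ m * u ^+ m = horner_alg x p.
Proof.
move=> xu vu; elim: m => [|m [p p0 IHm]].
  by exists 1; rewrite ?hornerC // rmorph1 mul1r.
have [r r0 pu] := horner_alg_swap p xu.
exists ((1 - b *: 'X) * r).
  by rewrite hornerM hornerD hornerN hornerZ hornerX hornerC mulr0 subr0 mul1r r0.
rewrite exprS exprSr mulrA -[v * _ * _]mulrA IHm -mulrA pu mulrA vu.
by rewrite rmorphM rmorphB /= -mul_polyC rmorphM /= rmorph1 horner_algX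
  horner_algC -scalerAl mul1r.
Qed.

(** Stated abstractly because it is applied twice: with u = z0, y = z1 and with u, y their stars.
    The brackets isolate the factors that will carry the weight opposite to v^m and y'^n. *)
Lemma exprM_bezout (x u v y y' : A) c b m n :
  x * u = c *: (u * x) -> v * u = 1 - b *: x -> y' * y = x -> GRing.comm y' y ->
  exists f g : {poly F}, v ^+ m * (u ^+ m * horner_alg x f) +
                         y' ^+ n * (y ^+ n * horner_alg x g) = 1.
Proof.
move=> xu vu yx yy; have [p p0 vup] := exprM_horner_alg m xu vu.
have /Bezout_eq1_coprimepP[[f g] /= fg1] : coprimep p ('X ^+ n).
  rewrite coprimep_sym coprimep_expl // coprimep_sym coprimepX.
  by rewrite rootE p0 oner_eq0.
exists f, g; rewrite !mulrA vup -exprMn_comm // yx.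
have -> : x ^+ n = horner_alg x 'X^n by rewrite rmorphXn /= horner_algX.
by rewrite -!rmorphM -rmorphD /= mulrC [_ * g]mulrC fg1 rmorph1.
Qed.

End CommutationBezout.

(** * Weight spaces of the circle action on the quantum sphere *)

Section Weights.
Variables (C : numClosedFieldType) (q : C) (k l : nat).
Hypothesis q0 : q != 0.

Local Notation star := (@sq3_starq C q).
Local Notation z0 := (sq3_z0 q).
Local Notation z1 := (sq3_z1 q).
Local Notation rot := (fun w : C => @sq3_rot C q (w ^+ k) (w ^+ l)).

Definition weight_space (n : int) (x : sq3 q) : Prop :=
  forall w : C, `|w| = 1 -> rot w x = w ^ n *: x.

Let norm_neq0 (w : C) : `|w| = 1 -> w != 0.
Proof. by move=> w1; rewrite -normr_eq0 w1 oner_eq0. Qed.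

Let normX (w : C) n : `|w| = 1 -> `|w ^+ n| = 1.
Proof. by move=> w1; rewrite normrX w1 expr1n. Qed.

Lemma weight_sub n c x y :
  weight_space n x -> weight_space n y -> weight_space n (c *: x + y).
Proof.
move=> wx wy w w1; rewrite sq3_rotD ?sq3_rotZ ?normX // wx // wy //.
by rewrite scalerDr !scalerA mulrC.
Qed.

Lemma weight_0 n : weight_space n 0.
Proof.
move=> w w1; rewrite -(scale0r (0 : sq3 q)) sq3_rotZ ?normX //.
by rewrite !scale0r scaler0.
Qed.

Lemma weight_Z n c x : weight_space n x -> weight_space n (c *: x).
Proof.
move=> wx; rewrite -[_ *: _]addr0; apply: weight_sub => //; exact: weight_0.
Qed.

Lemma weight_D n x y :
  weight_space n x -> weight_space n y -> weight_space n (x + y).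
Proof. by move=> wx wy; rewrite -[x]scale1r; exact: weight_sub. Qed.

Lemma weight_1 : weight_space 0 1.
Proof. by move=> w w1; rewrite sq3_rot1 ?normX // expr0z scale1r. Qed.

Lemma weight_M m n x y :
  weight_space m x -> weight_space n y -> weight_space (m + n) (x * y).
Proof.
move=> wx wy w w1; rewrite sq3_rotM ?normX // wx // wy //.
by rewrite -scalerAl -scalerAr scalerA -expfzDr // norm_neq0.
Qed.

Lemma weight_X n x m : weight_space n x -> weight_space (n * m%:Z) (x ^+ m).
Proof.
move=> wx; elim: m => [|m IHm]; first by rewrite mulr0; exact: weight_1.
by rewrite exprS intS mulrDr mulr1; exact: weight_M.
Qed.

Lemma rot_star w x : `|w| = 1 -> rot w (star x) = star (rot w x).
Proof.
move=> w1; rewrite -(sq3_reprK x) sq3_starqE !sq3_rot_class ?normX //.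
Qed.

Lemma weight_star n x : weight_space n x -> weight_space (- n) (star x).
Proof.
move=> wx w w1; rewrite rot_star // wx // sq3_starqZ; congr (_ *: _).
have wV : (w^* )%R = w^-1.
  rewrite -[LHS]mulr1 -(divff (norm_neq0 w1)) mulrA [_ * w]mulrC -normCK w1.
  by rewrite expr1n mul1r.
have rX (m : nat) : ((w ^+ m)^* )%R = w ^- m by rewrite rmorphXn /= wV exprVn.
case: n {wx} => n; first by rewrite -exprnP rX exprnN.
by rewrite NegzE opprK -exprnN -rX conjCK.
Qed.

Lemma weight_z0 : weight_space k z0.
Proof. by move=> w w1; rewrite /= sq3_rot_class ?normX. Qed.

Lemma weight_z1 : weight_space l z1.
Proof. by move=> w w1; rewrite /= sq3_rot_class ?normX. Qed.

Lemma weight_horner x p : weight_space 0 x -> weight_space 0 (horner_alg x p).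
Proof.
move=> wx; elim/poly_ind: p => [|p c IHp].
  by rewrite rmorph0; exact: weight_0.
rewrite rmorphD rmorphM /= horner_algX horner_algC.
by apply: weight_D; [rewrite -[0]addr0; exact: weight_M|exact/weight_Z/weight_1].
Qed.

Lemma teardrop_weight x : (x \in teardrop q k l) <-> weight_space 0 x.
Proof.
split=> [/asboolP fx w w1|wx]; first by rewrite expr0z scale1r fx.
by apply/asboolP => w w1; rewrite wx // expr0z scale1r.
Qed.

(** Structural induction on a representing term: the generators are weight vectors, and sums,
    products, scalings and stars of sums of weight vectors are again such sums. *)
Lemma weight_decomposes : forall x : sq3 q, exists2 s : seq (int * sq3 q),
  forall p, p \in s -> weight_space p.1 p.2 & x = \sum_(p <- s) p.2.
Proof.
move=> x; rewrite -(sq3_reprK x); move: (sq3_repr x) => t {x}.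
have one n x : weight_space n x -> exists2 s : seq (int * sq3 q),
    forall p, p \in s -> weight_space p.1 p.2 & x = \sum_(p <- s) p.2.
  move=> wx; exists [:: (n, x)]; last by rewrite big_seq1.
  by move=> p; rewrite inE => /eqP ->.
elim: t => [||||t [s sw IHs] t' [s' sw' IHs']|t [s sw IHs] t' [s' sw' IHs']
           |c t [s sw IHs]|t [s sw IHs]].
- exact: one weight_z0.
- exact: one weight_z1.
- by exists [::]; rewrite ?big_nil.
- exact: one weight_1.
- exists (s ++ s'); last by rewrite big_cat -IHs -IHs' [RHS]sq3_classD.
  by move=> p; rewrite mem_cat => /orP[/sw|/sw'].
- exists [seq (p.1 + p'.1, p.2 * p'.2) | p <- s, p' <- s'].
    by move=> _ /allpairsP[[p p'] /= [/sw wp /sw' wp' ->]]; exact: weight_M.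
  rewrite big_allpairs_dep /= -sq3_classM IHs IHs' mulr_suml.
  by apply: eq_bigr => p _; rewrite mulr_sumr.
- exists [seq (p.1, c *: p.2) | p <- s].
    by move=> _ /mapP[p /sw wp ->]; exact: weight_Z.
  by rewrite big_map -scaler_sumr -IHs sq3_classZ.
- exists [seq (- p.1, star p.2) | p <- s].
    by move=> _ /mapP[p /sw wp ->]; exact: weight_star.
  have star0 : star 0 = 0.
    by rewrite -(scale0r (0 : sq3 q)) sq3_starqZ rmorph0 !scale0r.
  by rewrite big_map -(big_morph star (@sq3_starqD C q) star0) -IHs sq3_starqE.
Qed.

Lemma rot_sum w (s : seq (int * sq3 q)) (a : int -> C) : `|w| = 1 ->
  (forall p, p \in s -> weight_space p.1 p.2) ->
  rot w (\sum_(p <- s) a p.1 *: p.2) = \sum_(p <- s) (a p.1 * w ^ p.1) *: p.2.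
Proof.
move=> w1 sw; have rotD := sq3_rotD (normX k w1) (normX l w1) (q := q).
have rot0 : rot w 0 = 0 by rewrite (@weight_0 0) // scaler0.
rewrite (big_morph _ rotD rot0) !big_seq; apply: eq_bigr => p ps.
by rewrite sq3_rotZ ?normX // sw // scalerA.
Qed.

Lemma weight_direct (s : seq (int * sq3 q)) :
  (forall M, (0 < M)%N -> exists z : C, M.-primitive_root z) ->
  (forall p, p \in s -> weight_space p.1 p.2) -> \sum_(p <- s) p.2 = 0 ->
  forall n, \sum_(p <- s | p.1 == n) p.2 = 0.
Proof.
(* M exceeds every |p.1 - n|, so the only weight in [s] congruent to n modulo M is n itself. *)
move=> roots sw s0 n; pose M := (\sum_(p <- s) `|p.1 - n|%N).+1.
have [z zM] := roots M isT.
have z1 : `|z| = 1.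
  apply/eqP; rewrite -(@pexpr_eq1 _ _ M) //.
  by rewrite -normrX (prim_expr_order zM) normr1.
have -> : \sum_(p <- s | p.1 == n) p.2 = \sum_(p <- s | (M %| p.1 - n)%Z) p.2.
  rewrite big_seq_cond [RHS]big_seq_cond; apply: eq_bigl => p.
  case: (boolP (p \in s)) => //= ps; rewrite -subr_eq0.
  apply/eqP/idP => [->|]; first exact: dvdz0.
  rewrite dvdzE absz_nat => dM; apply/eqP; rewrite -absz_eq0.
  case: (posnP `|p.1 - n|%N) => [//|pn0].
  have := dvdn_leq pn0 dM.
  by rewrite leqNgt ltnS (big_rem p) //= leq_addr.
rewrite -(root_average zM) big1 ?scaler0 // => j _.
have zj1 : `|z ^+ j| = 1 by exact: normX.
(* Each term of the average is a multiple of a rotation of the total sum, which is zero. *)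
transitivity ((z ^+ j) ^ (- n) *: rot (z ^+ j) (\sum_(p <- s) (1 : C) *: p.2)).
  rewrite (rot_sum (fun=> 1)) // scaler_sumr; apply: eq_bigr => p _.
  by rewrite scalerA mul1r -expfzDr ?norm_neq0 // addrC.
under eq_bigr do rewrite scale1r.
by rewrite s0 (@weight_0 0) // !scaler0.
Qed.

(** A fixed element equals its average over the rotations by powers of z, and this average removes
    every weight not divisible by M. *)
Lemma rot_fixed_weights (M : nat) (z : C) (x : sq3 q) :
  M.-primitive_root z -> `|z| = 1 -> rot z x = x ->
  exists2 s : seq (int * sq3 q),
    forall p, p \in s -> weight_space p.1 p.2 /\ (M %| p.1)%Z &
    x = \sum_(p <- s) p.2.
Proof.
move=> zM z1 zx; have [s sw xs] := weight_decomposes x.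
exists [seq p <- s | (M %| p.1)%Z].
  by move=> p; rewrite mem_filter => /andP[? /sw].
rewrite big_filter.
have -> : \sum_(p <- s | (M %| p.1)%Z) p.2 = \sum_(p <- s | (M %| p.1 - 0)%Z) p.2.
  by apply: eq_bigl => p; rewrite subr0.
rewrite -(root_average zM).
have xj (j : nat) : \sum_(p <- s) (z ^+ j) ^ p.1 *: p.2 = x.
  elim: j => [|j IHj].
    by rewrite xs; apply: eq_bigr => p _; rewrite exp1rz scale1r.
  rewrite -[RHS]zx -[in RHS]IHj (rot_sum (fun n => (z ^+ j) ^ n)) //.
  by apply: eq_bigr => p _; rewrite exprSr expfzMl.
rewrite (eq_bigr (fun=> x)) => [|j _]; last first.
  by rewrite -[RHS](xj j); apply: eq_bigr => p _; rewrite subr0.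
rewrite sumr_const card_ord -scaler_nat scalerA mulVf ?scale1r //.
exact: prim_root_natf_neq0 zM.
Qed.

Local Notation x1 := (z1 * star z1).

Lemma x1_z0 : x1 * z0 = q ^- 2 *: (z0 * x1).
Proof.
have -> : z0 * x1 = q ^+ 2 *: (x1 * z0).
  rewrite mulrA sq3_rel_z0z1 -scalerAl -[_ * z0 * _]mulrA sq3_rel_z0z1s.
  by rewrite -scalerAr scalerA mulrA.
by rewrite scalerA mulVf ?expf_neq0 // scale1r.
Qed.

(** Applying star to the relation for z0 z1 would introduce the conjugate of q. Instead x1 is
    replaced by 1 - z0 [star z0], and the commutator with [star z0] is computed from the relation
    between z0 [star z0] and [star z0] z0. *)
Lemma x1_z0s : x1 * star z0 = q ^+ 2 *: (star z0 * x1).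
Proof.
have x1E : x1 = 1 - z0 * star z0 by rewrite -(sq3_rel_sphere q) addrC addKr.
have : star z0 * x1 - x1 * star z0 = (q ^- 2 - 1) *: (x1 * star z0).
  have -> : (q ^- 2 - 1) *: (x1 * star z0) =
      (z0 * star z0 - star z0 * z0) * star z0.
    by rewrite sq3_rel_z0z0s addrAC subrr add0r scalerAl.
  by rewrite x1E mulrBr !mulrBl mulr1 mul1r mulrA opprB addrC addrA subrK.
move/eqP; rewrite scalerBl scale1r subr_eq subrK => /eqP ->.
by rewrite scalerA mulfV ?expf_neq0 // scale1r.
Qed.

Lemma z0s_z0 : star z0 * z0 = 1 - q ^- 2 *: x1.
Proof.
rewrite -[LHS](addrK ((q ^- 2 - 1) *: x1)) -sq3_rel_z0z0s -(sq3_rel_sphere q).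
by rewrite scalerBl scale1r opprB addrA.
Qed.

Lemma z0_z0s : z0 * star z0 = 1 - 1 *: x1.
Proof. by rewrite scale1r -(sq3_rel_sphere q) addrK. Qed.

Lemma weight_x1 : weight_space 0 x1.
Proof.
rewrite -(subrr (l%:Z)); exact: weight_M weight_z1 (weight_star weight_z1).
Qed.

(** The exponents l m and k m give z0 and z1 the common weight k l m, which the polynomials in x1,
    of weight 0, do not change. *)
Lemma weight_partition_star m : exists f g : sq3 q,
  [/\ weight_space (k * l * m)%N%:Z f, weight_space (k * l * m)%N%:Z g
    & star z0 ^+ (l * m) * f + star z1 ^+ (k * m) * g = 1].
Proof.
have z1C : star z1 * z1 = x1 by rewrite -sq3_rel_z1z1s.
have [f [g fg1]] := exprM_bezout (l * m) (k * m) x1_z0 z0s_z0 z1C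
  (esym (sq3_rel_z1z1s q)).
exists (z0 ^+ (l * m) * horner_alg x1 f), (z1 ^+ (k * m) * horner_alg x1 g).
split=> //.
  rewrite -[X in weight_space X]addr0 -mulnA PoszM.
  exact: weight_M (weight_X _ weight_z0) (weight_horner _ weight_x1).
rewrite -[X in weight_space X]addr0 [(k * l)%N]mulnC -mulnA PoszM.
exact: weight_M (weight_X _ weight_z1) (weight_horner _ weight_x1).
Qed.

Lemma weight_partition m : exists f g : sq3 q,
  [/\ weight_space (- (k * l * m)%N%:Z) f, weight_space (- (k * l * m)%N%:Z) g
    & z0 ^+ (l * m) * f + z1 ^+ (k * m) * g = 1].
Proof.
have [f [g fg1]] := exprM_bezout (l * m) (k * m) x1_z0s z0_z0s (erefl x1)
  (sq3_rel_z1z1s q).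
exists (star z0 ^+ (l * m) * horner_alg x1 f).
exists (star z1 ^+ (k * m) * horner_alg x1 g); split=> //.
  rewrite -[X in weight_space X]addr0 -mulnA PoszM -mulNr.
  exact: weight_M (weight_X _ (weight_star weight_z0)) (weight_horner _ weight_x1).
rewrite -[X in weight_space X]addr0 [(k * l)%N]mulnC -mulnA PoszM -mulNr.
exact: weight_M (weight_X _ (weight_star weight_z1)) (weight_horner _ weight_x1).
Qed.

(** The sign e treats both halves of [spectral_subspace] at once. For the converse, x = a0^(lm) (f
    x) + a1^(km) (g x) with f x and g x of weight 0, so the terms j = m and j = 0 suffice. *)
Lemma weight_span (a0 a1 f g x : sq3 q) (e : int) (m : nat) :
  weight_space (e * k%:Z) a0 -> weight_space (e * l%:Z) a1 ->
  weight_space (- (e * (k * l * m)%N%:Z)) f ->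
  weight_space (- (e * (k * l * m)%N%:Z)) g ->
  a0 ^+ (l * m) * f + a1 ^+ (k * m) * g = 1 ->
  (exists w : 'I_m.+1 -> sq3 q, (forall j, w j \in teardrop q k l) /\
     x = \sum_(j < m.+1) a0 ^+ (l * j) * a1 ^+ (k * (m - j)) * w j) <->
  weight_space (e * (k * l * m)%N%:Z) x.
Proof.
move=> wa0 wa1 wf wg fg1; split=> [[w [wB ->]]|wx].
  elim/big_ind: _ => [||j _]; [exact: weight_0|exact: weight_D|].
  have -> : e * (k * l * m)%N%:Z =
      e * k%:Z * (l * j)%N%:Z + e * l%:Z * (k * (m - j))%N%:Z + 0.
    rewrite addr0 -!mulrA -mulrDr -!PoszM -PoszD; congr (e * Posz _).
    by rewrite (mulnCA l k) -!mulnDr subnKC ?mulnA // -ltnS.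
  by apply: weight_M; [apply: weight_M; exact: weight_X|exact/teardrop_weight].
have weight0 h :
    weight_space (- (e * (k * l * m)%N%:Z)) h -> weight_space 0 (h * x).
  by move=> wh; rewrite -(addNr (e * (k * l * m)%N%:Z)); exact: weight_M.
(* The two contributions are added rather than selected by cases, since [ord_max] and [ord0]
   coincide when m = 0. *)
exists (fun j => (if j == ord_max then f * x else 0) +
                 (if j == ord0 then g * x else 0)); split=> [j|].
  by apply/teardrop_weight/weight_D; case: ifP => _;
    first [exact: weight0 | exact: weight_0].
under eq_bigr => j _ do rewrite mulrDr.
rewrite big_split /= (bigD1 ord_max) //= big1 => [|j /negPf ->]; last first.
  by rewrite mulr0.
rewrite [X in _ + X](bigD1 ord0) //= big1 => [|j /negPf ->]; last first.
  by rewrite mulr0.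
rewrite !eqxx subnn subn0 !muln0 !expr0 mulr1 mul1r !addr0 !mulrA -mulrDl.
by rewrite fg1 mul1r.
Qed.

Lemma spectral_weight n x :
  spectral_subspace q k l n x <-> weight_space (- ((k * l)%N%:Z * n)) x.
Proof.
case: n => [m|m].
  have [f [g [wf wg fg1]]] := weight_partition_star m.
  have := @weight_span (star z0) (star z1) f g x (-1) m; rewrite !mulN1r opprK.
  by apply=> //; [exact/weight_star/weight_z0|exact/weight_star/weight_z1].
have [f [g [wf wg fg1]]] := weight_partition m.+1.
have := @weight_span z0 z1 f g x 1 m.+1; rewrite !mul1r NegzE mulrN opprK -PoszM.
by apply=> //; [exact: weight_z0|exact: weight_z1].
Qed.

Lemma weight_strong n : exists a b a' b' : sq3 q,
  [/\ weight_space (- ((k * l)%N%:Z * n)) a, weight_space ((k * l)%N%:Z * n) b,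
      weight_space (- ((k * l)%N%:Z * n)) a', weight_space ((k * l)%N%:Z * n) b'
    & a * b + a' * b' = 1].
Proof.
case: n => [m|m].
  have [f [g [wf wg fg1]]] := weight_partition_star m.
  exists (star z0 ^+ (l * m)), f, (star z1 ^+ (k * m)), g.
  split=> //; rewrite -PoszM.
    by rewrite -mulnA PoszM -mulNr; exact/weight_X/weight_star/weight_z0.
  rewrite [(k * l)%N]mulnC -mulnA PoszM -mulNr.
  exact/weight_X/weight_star/weight_z1.
have [f [g [wf wg fg1]]] := weight_partition m.+1.
exists (z0 ^+ (l * m.+1)), f, (z1 ^+ (k * m.+1)), g.
rewrite NegzE mulrN opprK -PoszM; split=> //.
  by rewrite -mulnA PoszM; exact/weight_X/weight_z0.
by rewrite [(k * l)%N]mulnC -mulnA PoszM; exact/weight_X/weight_z1.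
Qed.

End Weights.

(** * The lens space *)

Section Expi.
Variable R : realType.

Lemma expiD (s t : R) : expi (s + t) = expi s * expi t.
Proof. by rewrite /expi cosD sinD; simpc; rewrite [cos s * sin t + _]addrC. Qed.

Lemma expi0 : expi (0 : R) = 1.
Proof. by rewrite /expi cos0 sin0. Qed.

Lemma expiX (t : R) n : expi t ^+ n = expi (n%:R * t).
Proof.
elim: n => [|n IHn]; first by rewrite mul0r expi0.
by rewrite exprS IHn -expiD -[n.+1]add1n natrD mulrDl mul1r.
Qed.

Lemma expi_prim M : (0 < M)%N -> M.-primitive_root (expi (2 * pi / M%:R : R)).
Proof.
move=> M0; have MR : M%:R != 0 :> R by rewrite pnatr_eq0 -lt0n.
apply/andP; split=> //; apply/forallP => i; rewrite unity_rootE expiX.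
case: (ltngtP i.+1 M) => [lt_iM|lt_Mi|->].
(* Half the angle: cos (2t) = 1 would force sin t = 0, although 0 < t < pi. *)
- pose t : R := i.+1%:R / M%:R * pi.
  have -> : i.+1%:R * (2 * pi / M%:R) = t *+ 2 :> R.
    by rewrite /t -mulr_natl; ring.
  apply/eqP/negbTE/eqP => /(congr1 (@complex.Re R)) /=.
  have t0pi : 0 < t < pi.
    rewrite mulr_gt0 ?pi_gt0 ?divr_gt0 ?ltr0n //=.
    by rewrite gtr_pMl ?pi_gt0 // ltr_pdivrMr ?ltr0n // mul1r ltr_nat.
  rewrite cos_mulr2n => c1; have := sin_gt0_pi t0pi.
  have := cos2Dsin2 t; nra.
- by have := ltn_ord i; rewrite leqNgt lt_Mi.
- rewrite mulrC divfK // mulr_natl /expi.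
  rewrite -[pi *+ 2]add0r cosD2pi sinD2pi cos0 sin0.
  by rewrite eqxx.
Qed.

End Expi.

(** * The grading of the lens space by weights *)

Section LensGrading.
Variables (R : realType) (q : R[i]) (k l d : nat).
Hypotheses (q0 : q != 0) (k0 : (0 < k)%N) (l0 : (0 < l)%N) (d0 : (0 < d)%N).

Local Notation M := (d * l * k)%N.
Local Notation z := (expi (2 * pi / M%:R : R)).
Local Notation G := (lens_grading q d k l).

Let M0 : (0 < M)%N. Proof. by rewrite !muln_gt0 d0 l0. Qed.

Lemma lens_gen_rot (x : sq3 q) : lens_gen d k l x = sq3_rot (z ^+ k) (z ^+ l) x.
Proof.
have kR : k%:R != 0 :> R by rewrite pnatr_eq0 -lt0n.
have lR : l%:R != 0 :> R by rewrite pnatr_eq0 -lt0n.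
have dR : d%:R != 0 :> R by rewrite pnatr_eq0 -lt0n.
have Ek : k%:R * (2 * pi / M%:R) = 2 * pi / (d * l)%:R :> R.
  by rewrite !natrM; field; rewrite kR lR dR.
have El : l%:R * (2 * pi / M%:R) = 2 * pi / (d * k)%:R :> R.
  by rewrite !natrM; field; rewrite kR lR dR.
by rewrite /lens_gen !expiX Ek El.
Qed.

Lemma weight_lens_fixed n x :
  weight_space k l (M%:Z * n) x -> x \in lens_fixed (q := q) d k l.
Proof.
move=> wx; apply/lens_fixedP; rewrite lens_gen_rot wx ?norm_expi //.
by rewrite -exprz_exp -exprnP (prim_expr_order (expi_prim R M0)) exp1rz scale1r.
Qed.

Lemma lens_gradingE n (x : lens q d k l) :
  G n x <-> weight_space k l (- (M%:Z * n)) (val x).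
Proof.
have -> : M%:Z * n = (k * l)%N%:Z * (d%:Z * n).
  by rewrite mulrA -PoszM -mulnA mulnC [(l * k)%N]mulnC.
exact: spectral_weight.
Qed.

Lemma lens_grading_lift n (x : sq3 q) : weight_space k l (M%:Z * n) x ->
  exists2 y : lens q d k l, val y = x & G (- n) y.
Proof.
move=> wx; exists (Sub x (weight_lens_fixed wx)); first by rewrite SubK.
by apply/lens_gradingE; rewrite SubK mulrN opprK.
Qed.

Lemma lens_grading_decomposes (x : lens q d k l) : exists s, decomposes G x s.
Proof.
have zM := expi_prim R M0.
have fx : sq3_rot (z ^+ k) (z ^+ l) (val x) = val x.
  by rewrite -lens_gen_rot; apply/lens_fixedP; exact: valP.
have [s sw xs] := rot_fixed_weights zM (norm_expi _) fx.
(* The weight vectors must be lifted to the lens space one by one; subtracting the lifted head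
   leaves an element of the lens space for the induction. *)
elim: s sw (x) xs {fx} => [|p s IHs] sw y ys.
  exists [::]; split=> //; apply: val_inj.
  by rewrite ys !big_nil rmorph0.
have [wp /dvdzP[n pn]] := sw p (mem_head _ _).
rewrite mulrC in pn; rewrite pn in wp.
have [y1 y1p Gy1] := lens_grading_lift wp.
have [||s' [sG sE]] := IHs _ (y - y1).
- by move=> r rs; apply: sw; rewrite inE rs orbT.
- by rewrite raddfB /= ys big_cons y1p addrC addKr.
(* Weight M n corresponds to degree -n, because positive degrees are generated by the stars of z0
   and z1. *)
exists ((- n, y1) :: s'); split; last by rewrite big_cons -sE addrC subrK.
by move=> r; rewrite inE => /orP[/eqP ->|/sG].
Qed.

Lemma lens_grading_direct (s : seq (int * lens q d k l)) :
  (forall p, p \in s -> G p.1 p.2) -> \sum_(p <- s) p.2 = 0 ->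
  forall n, \sum_(p <- s | p.1 == n) p.2 = 0.
Proof.
move=> sG s0 n; apply: val_inj; rewrite rmorph0 raddf_sum.
pose s' := [seq (- (M%:Z * p.1), val p.2) | p <- s].
have roots N : (0 < N)%N -> exists w : R[i], N.-primitive_root w.
  by move=> N0; eexists; exact: expi_prim.
have s'w p : p \in s' -> weight_space k l p.1 p.2.
  by case/mapP => r /sG/lens_gradingE wr ->.
have s'0 : \sum_(p <- s') p.2 = 0.
  by rewrite big_map -(raddf_sum val) s0 raddf0.
rewrite -[RHS](weight_direct roots s'w s'0 (- (M%:Z * n))) big_map.
(* Passing from degrees to weights is injective because M > 0. *)
by apply: eq_bigl => p /=; rewrite eqr_opp (inj_eq (mulfI _)) // -lt0n.
Qed.

Lemma lens_grading_strong n : exists2 s : seq (lens q d k l * lens q d k l),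
  (forall p, p \in s -> G n p.1 /\ G (- n) p.2) & \sum_(p <- s) p.1 * p.2 = 1.
Proof.
have [a [b [a' [b' [wa wb wa' wb' ab]]]]] := weight_strong k l q0 (d%:Z * n).
have E : (k * l)%N%:Z * (d%:Z * n) = M%:Z * n.
  by rewrite mulrA -PoszM -[in RHS]mulnA [in RHS]mulnC [(l * k)%N]mulnC.
rewrite E -mulrN in wa wa' wb wb'.
have [x xa Gx] := lens_grading_lift wa; have [y yb Gy] := lens_grading_lift wb.
have [x' xa' Gx'] := lens_grading_lift wa'.
have [y' yb' Gy'] := lens_grading_lift wb'.
rewrite opprK in Gx Gx'; exists [:: (x, y); (x', y')].
  by move=> p; rewrite !inE => /orP[] /eqP ->.
apply: val_inj; rewrite !big_cons big_nil addr0 rmorphD !rmorphM rmorph1.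
by rewrite /= xa yb xa' yb'.
Qed.

Lemma lens_principal_bundle :
  quantum_principal_U1_bundle (lens_coaction q d k l) (teardrop_in_lens q d k l).
Proof.
apply: strongly_graded_principal_bundle.
- move=> n c x y /lens_gradingE wx /lens_gradingE wy; apply/lens_gradingE.
  by rewrite linearP; exact: weight_sub.
- by move=> n; apply/lens_gradingE; rewrite rmorph0; exact: weight_0.
- by apply/lens_gradingE; rewrite rmorph1 mulr0 oppr0; exact: weight_1.
- move=> m n x y /lens_gradingE wx /lens_gradingE wy; apply/lens_gradingE.
  by rewrite rmorphM mulrDr opprD; exact: weight_M.
- exact: lens_grading_decomposes.
- exact: lens_grading_direct.
- exact: lens_grading_strong.
- move=> x; split.
    by move/teardrop_weight => wx; apply/lens_gradingE; rewrite mulr0 oppr0.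
  by move/lens_gradingE; rewrite mulr0 oppr0 => /teardrop_weight.
Qed.

End LensGrading.

Theorem proposition6p5 (R : realType) (q : R) (k l d : nat)
    (hq0 : 0 < q) (hq1 : q < 1)
    (hk : (0 < k)%N) (hl : (0 < l)%N) (hkl : coprime k l) (hd : (0 < d)%N) :
  quantum_principal_U1_bundle (lens_coaction q%:C d k l)
    (teardrop_in_lens q%:C d k l).
Proof.
apply: lens_principal_bundle => //.
by rewrite eq_complex /= eqxx andbT gt_eqF.
Qed.
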